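(* Let $\Omega\subset\mathbb{C}^d$ be a complete Kobayashi hyperbolic domain that is hyperbolically embedded in $\mathbb{C}^d$, and suppose $\Omega$ is locally model-Gromov-hyperbolic. Then for every $x\in\partial\Omega$, $o\in\Omega$ and $R>0$, $\overline{H^s_o(x,R)}\cap\partial\Omega=\overline{H^b_o(x,R)}\cap\partial\Omega=\{x\}$.
   Context: For a Kobayashi hyperbolic domain $\Omega\subset\mathbb{C}^d$ with Kobayashi distance $\mathsf{k}_\Omega$, $x\in\partial\Omega$ (boundary in $\mathbb{C}^d$), $o\in\Omega$, $R>0$: $H^s_o(x,R)=\{z\in\Omega:\limsup_{w\to x}(\mathsf{k}_\Omega(z,w)-\mathsf{k}_\Omega(o,w))<\tfrac12\log R\}$ and $H^b_o(x,R)=\{z\in\Omega:\liminf_{w\to x}(\mathsf{k}_\Omega(z,w)-\mathsf{k}_\Omega(o,w))<\tfrac12\log R\}$; closures are in $\mathbb{C}^d$. Complete Kobayashi hyperbolic: $(\Omega,\mathsf{k}_\Omega)$ is Cauchy complete. $\Omega$ is hyperbolically embedded in $\mathbb{C}^d$ if for all distinct $x,y\in\partial\Omega$, $\liminf_{z\to x,w\to y}\mathsf{k}_\Omega(z,w)>0$. A domain $V$ is model-Gromov-hyperbolic if $(V,\mathsf{k}_V)$ is Gromov hyperbolic and the identity of $V$ extends to a homeomorphism from the Gromov compactification $\overline{V}^G$ onto the end-point compactification $\overline{V}^{End}$ (the closure of $V$ in $\mathbb{C}^d$ with one point added for each end at infinity; equal to $\overline V$ for bounded $V$). $\Omega$ is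 locally model-Gromov-hyperbolic if for every $x\in\partial\Omega$ there is a $\mathbb{C}^d$-neighbourhood $U_x$ of $x$ such that $\Omega\cap U_x$ is connected and is a model-Gromov-hyperbolic domain (with its own Kobayashi distance). *)

(* Defs.v *)
(* C = R[i] (complex numbers over a realType R),
   C^d = 'rV[(R[i])^o]_d with its canonical (product = Euclidean) topology. *)
From mathcomp Require Import all_boot all_order all_algebra.
From mathcomp Require Import all_classical all_reals all_analysis.
From mathcomp Require Import complex.
Import Order.TTheory GRing.Theory Num.Theory numFieldNormedType.Exports.

Set Implicit Arguments.
Unset Strict Implicit.
Unset Printing Implicit Defensive.

Local Open Scope ring_scope.
Local Open Scope classical_set_scope.

Notation Cplx R := ((R[i])^o).
Notation Cd R d := ('rV[(R[i])^o]_d).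

Section Kobayashi.
Variables (R : realType) (d : nat).

Definition cabs (z : R[i]) : R := complex.Re `|z|.

(* (max-)norm on C^d, as a real number; it induces the Euclidean topology *)
Definition nrm (z : Cd R d) : R := complex.Re `|z|.

Definition poincare (a b : R[i]) : R :=
  let t := cabs ((a - b) / (1 - a^* * b)) in 2^-1 * ln ((1 + t) / (1 - t)).

Definition holo_disc (Om : set (Cd R d)) (f : Cplx R -> Cd R d) : Prop :=
  forall z : Cplx R, cabs z < 1 -> derivable f z 1 /\ Om (f z).

Definition kob_chain_lengths (Om : set (Cd R d)) (z w : Cd R d) : set R :=
  [set s | exists (n : nat) (p : nat -> Cd R d) (f : nat -> Cplx R -> Cd R d)
              (a b : nat -> Cplx R),
     [/\ p 0%N = z, p n = w,
         (forall j, (j < n)%N ->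
            [/\ holo_disc Om (f j), cabs (a j) < 1, cabs (b j) < 1,
                f j (a j) = p j & f j (b j) = p j.+1])
       & s = \sum_(j < n) poincare (a j) (b j)]].

Definition kob (Om : set (Cd R d)) (z w : Cd R d) : R :=
  inf (kob_chain_lengths Om z w).

Definition domain (Om : set (Cd R d)) : Prop :=
  [/\ open Om, connected Om & Om !=set0].

Definition bdry (Om : set (Cd R d)) : set (Cd R d) := closure Om `\` Om.

Definition kob_hyperbolic (Om : set (Cd R d)) : Prop :=
  forall z w, Om z -> Om w -> kob Om z w = 0 -> z = w.

Definition kob_complete (Om : set (Cd R d)) : Prop :=
  kob_hyperbolic Om /\
  forall u : nat -> Cd R d, (forall n, Om (u n)) ->
    (forall eps : R, 0 < eps -> exists N, forall m n, (N <= m)%N -> (N <= n)%N ->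
        kob Om (u m) (u n) < eps) ->
    exists p, Om p /\
      (forall eps : R, 0 < eps -> exists N, forall n, (N <= n)%N -> kob Om (u n) p < eps).

Definition eball (x : Cd R d) (r : R) : set (Cd R d) := [set w | nrm (w - x) < r].

Definition kob_liminf2 (Om : set (Cd R d)) (x y : Cd R d) : \bar R :=
  ereal_sup [set ereal_inf [set (kob Om zw.1 zw.2)%:E |
                 zw in [set zw | [/\ Om zw.1, Om zw.2, eball x r zw.1 & eball y r zw.2]]]
            | r in [set r : R | 0 < r]].

Definition hyp_embedded (Om : set (Cd R d)) : Prop :=
  forall x y, bdry Om x -> bdry Om y -> x <> y -> (0 < kob_liminf2 Om x y)%E.

Definition busemann_limsup (Om : set (Cd R d)) (o z x : Cd R d) : \bar R :=
  ereal_inf [set ereal_sup [set (kob Om z w - kob Om o w)%:E | w in Om `&` eball x r]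
            | r in [set r : R | 0 < r]].

Definition busemann_liminf (Om : set (Cd R d)) (o z x : Cd R d) : \bar R :=
  ereal_sup [set ereal_inf [set (kob Om z w - kob Om o w)%:E | w in Om `&` eball x r]
            | r in [set r : R | 0 < r]].

Definition horo_s (Om : set (Cd R d)) (o x : Cd R d) (Rr : R) : set (Cd R d) :=
  [set z | Om z /\ (busemann_limsup Om o z x < (2^-1 * ln Rr)%:E)%E].

Definition horo_b (Om : set (Cd R d)) (o x : Cd R d) (Rr : R) : set (Cd R d) :=
  [set z | Om z /\ (busemann_liminf Om o z x < (2^-1 * ln Rr)%:E)%E].

Definition gprod (V : set (Cd R d)) (o x y : Cd R d) : R :=
  2^-1 * (kob V x o + kob V y o - kob V x y).

Definition gromov_hyperbolic (V : set (Cd R d)) : Prop :=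
  exists delta : R, 0 <= delta /\
    forall o x y z, V o -> V x -> V y -> V z ->
      Num.min (gprod V o x y) (gprod V o y z) - delta <= gprod V o x z.

Definition gromov_seq (V : set (Cd R d)) (o : Cd R d) (s : nat -> Cd R d) : Prop :=
  (forall n, V (s n)) /\
  forall M : R, exists N, forall m n, (N <= m)%N -> (N <= n)%N -> M <= gprod V o (s m) (s n).

Definition gromov_equiv (V : set (Cd R d)) (o : Cd R d) (s t : nat -> Cd R d) : Prop :=
  forall M : R, exists N, forall n, (N <= n)%N -> M <= gprod V o (s n) (t n).

Definition gbdry_pt (V : set (Cd R d)) (o : Cd R d) (Xi : set (nat -> Cd R d)) : Prop :=
  exists s, gromov_seq V o s /\ Xi = [set t | gromov_seq V o t /\ gromov_equiv V o s t].

(* points of the Gromov compactification: inl z (z in V) or inr xi (xi in the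
   Gromov boundary) *)
Definition GC := (Cd R d + set (nat -> Cd R d))%type.

Definition gc_carrier (V : set (Cd R d)) (o : Cd R d) : set GC :=
  fun p => match p with inl z => V z | inr Xi => gbdry_pt V o Xi end.

Definition eliminf (u : nat -> R) : \bar R :=
  ereal_sup [set ereal_inf [set (u n)%:E | n in [set n | (N <= n)%N]] | N in [set: nat]].

Definition eliminf2 (u : nat -> nat -> R) : \bar R :=
  ereal_sup [set ereal_inf [set (u ij.1 ij.2)%:E | ij in [set ij | (N <= ij.1)%N /\ (N <= ij.2)%N]]
            | N in [set: nat]].

Definition gprod_bd (V : set (Cd R d)) (o : Cd R d) (p : GC) (Xi : set (nat -> Cd R d))
  : \bar R :=
  match p with
  | inl x => ereal_inf [set eliminf (fun j => gprod V o x (t j)) | t in Xi]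
  | inr T => ereal_inf [set eliminf2 (fun i j => gprod V o (st.1 i) (st.2 j))
                        | st in [set st | T st.1 /\ Xi st.2]]
  end.

Definition gc_basic (V : set (Cd R d)) (o : Cd R d) (p : GC) (r : R) : set GC :=
  match p with
  | inl z => [set q | exists w, [/\ q = inl w, V w & kob V z w < r]]
  | inr Xi => [set q | gc_carrier V o q /\ (r%:E < gprod_bd V o q Xi)%E]
  end.

Definition gc_open (V : set (Cd R d)) (o : Cd R d) (O : set GC) : Prop :=
  O `<=` gc_carrier V o /\
  forall p, O p -> exists r : R, 0 < r /\ gc_basic V o p r `<=` O.

Definition cball0 (n : nat) : set (Cd R d) := [set w | nrm w <= n%:R].

Definition is_end (V : set (Cd R d)) (e : nat -> set (Cd R d)) : Prop :=
  forall n : nat,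
    [/\ (exists y, e n y /\ e n = connected_component (closure V `\` cball0 n) y),
        (forall M : R, exists y, e n y /\ M < nrm y)
      & e n.+1 `<=` e n].

Definition EC := (Cd R d + (nat -> set (Cd R d)))%type.

Definition ec_carrier (V : set (Cd R d)) : set EC :=
  fun p => match p with inl y => closure V y | inr e => is_end V e end.

Definition ec_basic (V : set (Cd R d)) (p : EC) (r : R) (n : nat) : set EC :=
  match p with
  | inl y => [set q | exists w, [/\ q = inl w, closure V w & nrm (w - y) < r]]
  | inr e => [set q | match q with
                      | inl w => e n w
                      | inr e' => is_end V e' /\ e' n = e n
                      end]
  end.

Definition ec_open (V : set (Cd R d)) (O : set EC) : Prop :=
  O `<=` ec_carrier V /\
  forall p, O p -> exists (r : R) (n : nat), 0 < r /\ ec_basic V p r n `<=` O.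

Definition gc_ec_homeo (V : set (Cd R d)) (o : Cd R d) : Prop :=
  exists phi : GC -> EC,
    (forall z, V z -> phi (inl z) = inl z) /\
    [/\ (forall p, gc_carrier V o p -> ec_carrier V (phi p)),
        (forall p q, gc_carrier V o p -> gc_carrier V o q -> phi p = phi q -> p = q),
        (forall q, ec_carrier V q -> exists p, gc_carrier V o p /\ phi p = q),
        (forall O, ec_open V O -> gc_open V o (gc_carrier V o `&` phi @^-1` O))
      & (forall O, gc_open V o O -> ec_open V (phi @` O))].

Definition model_gromov_hyperbolic (V : set (Cd R d)) : Prop :=
  [/\ domain V, kob_hyperbolic V, gromov_hyperbolic V
    & (exists o, V o /\ gc_ec_homeo V o)].

Definition locally_model_gromov_hyperbolic (Om : set (Cd R d)) : Prop :=
  forall x, bdry Om x ->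
    exists U : set (Cd R d),
      [/\ open U, U x, connected (Om `&` U) & model_gromov_hyperbolic (Om `&` U)].

End Kobayashi.

(* Main.v *)
Require Import Defs.
From mathcomp Require Import all_boot all_order all_algebra.
From mathcomp Require Import all_classical all_reals all_analysis.
From mathcomp Require Import complex ring lra zify.
Import Order.TTheory GRing.Theory Num.Theory numFieldNormedType.Exports.
Local Open Scope ring_scope.
Local Open Scope classical_set_scope.

Set Implicit Arguments.
Unset Strict Implicit.
Unset Printing Implicit Defensive.

(* Let V = Om `&` U be a model-Gromov-hyperbolic piece near the boundary point x.
   Hyperbolic embeddedness keeps k_Om bounded below between concentric spheres
   around x, so Royden's localization gives k_V <= A s for short chains of
   k_Om-length s near x; hence almost geodesics of Om are quasi-geodesics of V as
   long as they stay near x. Stability of quasi-geodesics in the Gromov hyperbolic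
   space V, and the identification of its Gromov boundary with the Euclidean one
   at x, show that, up to an additive constant,
   - k_Om(w,t) >= k_Om(w,o) + k_Om(o,t) for w near x and t away from x, so points
     of a big horosphere at x cannot accumulate elsewhere, since k_Om(o,t) tends
     to infinity at the boundary;
   - k_Om(w,o) >= k_Om(w,z) + k_Om(z,o) for some z arbitrarily close to x and all
     w close enough to x, so small horospheres do accumulate at x.
   No geodesics are needed: everything is done with discrete almost-minimizing
   chains, and completeness enters only through hyperbolicity. *)

(** * Quasi-geodesics in Gromov hyperbolic spaces *)
Section QuasiGeodesics.
Context {R : realType} {T : Type}.
Implicit Types (X : set T) (D : T -> T -> R) (A B C eps eta delta : R).
Implicit Types (p g : nat -> T) (l : nat -> R).

(** For [D = kob V] this is convertible with [gprod V], so the results below apply directly to model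
    domains. *)
Definition gromov_product D (o x y : T) : R :=
  2^-1 * (D x o + D y o - D x y).

Definition pseudometric X D : Prop :=
  [/\ forall x, X x -> D x x = 0,
      forall x y, X x -> X y -> D x y = D y x
    & forall x y z, X x -> X y -> X z -> D x z <= D x y + D y z].

Definition hyperbolic X D delta : Prop :=
  forall o x y z, X o -> X x -> X y -> X z ->
    Num.min (gromov_product D o x y) (gromov_product D o y z) - delta
      <= gromov_product D o x z.

(** The parameter [l] plays the role of arc length. The lower bound has no multiplicative constant
    because [l] will be length in a larger domain, where distances are smaller and the path is
    almost minimizing. The case [A = 1] gives almost geodesics. *)
Definition quasigeodesic X D A eps eta p l (n : nat) : Prop :=
  [/\ forall i, (i <= n)%N -> X (p i),
      forall i j, (i <= j)%N -> (j <= n)%N ->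
        [/\ l i <= l j, D (p i) (p j) <= A * (l j - l i)
          & l j - l i <= D (p i) (p j) + eps]
    & forall i, (i < n)%N -> l i.+1 - l i <= eta].

Lemma hyperbolicP X D delta o x y z B : hyperbolic X D delta ->
  X o -> X x -> X y -> X z ->
  B <= gromov_product D o x y -> B <= gromov_product D o y z ->
  B - delta <= gromov_product D o x z.
Proof.
move=> hX Xo Xx Xy Xz B1 B2.
apply: le_trans (hX o x y z Xo Xx Xy Xz).
by rewrite lerD2r le_min B1 B2.
Qed.

Lemma gromov_productC X D o x y : pseudometric X D -> X x -> X y ->
  gromov_product D o x y = gromov_product D o y x.
Proof.
by move=> [_ sD _] Xx Xy; rewrite /gromov_product (sD x y) // (addrC (D x o)).
Qed.

Lemma pseudometric_ge0 X D x y : pseudometric X D -> X x -> X y -> 0 <= D x y.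
Proof.
move=> [D0 sD tD] Xx Xy; have := tD x y x Xx Xy Xx.
rewrite D0 // (sD y x) //; lra.
Qed.

(* A path that avoids the ball of radius B around q loses only
   logarithmically many delta's: halve the path repeatedly. *)
Lemma exponential_divergence X D delta A eps eta p l n q B k i j :
  pseudometric X D -> hyperbolic X D delta -> 0 <= delta -> 0 <= A -> 0 <= eta ->
  quasigeodesic X D A eps eta p l n -> X q ->
  (i <= j)%N -> (j <= n)%N ->
  (forall m, (i <= m)%N -> (m <= j)%N -> B <= D (p m) q) ->
  A * (l j - l i) <= 2 ^+ k ->
  B - (1 + A * eta) - k%:R * (2 * delta) <= gromov_product D q (p i) (p j).
Proof.
move=> pD hX d0 A0 eta0 [pX pl pe] Xq.
have Ae0 : 0 <= A * eta by apply: mulr_ge0.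
elim: k i j => [|k IH] i j ij jn Bm lij.
  have [_ h1 _] := pl i j ij jn.
  have b1 := Bm i (leqnn _) ij; have b2 := Bm j ij (leqnn _).
  rewrite expr0 in lij; rewrite /gromov_product; lra.
have [sm|big] := leP (A * (l j - l i)) (2 ^+ k).
  have := IH i j ij jn Bm sm; rewrite -[in X in _ -> X]natr1; lra.
(* At the first index [m] where the part after [i] exceeds [2 ^+ k], cut out the step that leads to
   [m]. Both remaining pieces fall under the induction hypothesis, the step itself is short, and two
   uses of hyperbolicity cost [2 * delta]. *)
have ex : exists m, (i <= m)%N && (2 ^+ k < A * (l m - l i)) by exists j; rewrite ij.
case: (ex_minnP ex) => m /andP[im mk] minm.
have mj : (m <= j)%N by apply: minm; rewrite ij.
have k0 : 0 <= 2 ^+ k :> R by apply: exprn_ge0.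
case: m im mk minm mj => [|m] im mk minm mj.
  by move: im mk; rewrite leqn0 => /eqP ->; rewrite subrr mulr0; lra.
have {}im : (i <= m)%N.
  move: im; rewrite leq_eqVlt => /orP[/eqP eim|//].
  by move: mk; rewrite eim subrr mulr0; lra.
have mk' : A * (l m - l i) <= 2 ^+ k.
  rewrite leNgt; apply/negP => h.
  by have := minm m; rewrite im h ltnn => /(_ isT).
have jn' : (m.+1 <= n)%N by apply: leq_trans jn.
have h1 := IH i m im (ltnW jn') (fun a b c => Bm a b (leq_trans c (ltnW mj))) mk'.
have h3 : B - (1 + A * eta) - k%:R * (2 * delta) <= gromov_product D q (p m.+1) (p j).
  apply: IH => //.
    by move=> a b c; apply: Bm => //; apply: leq_trans b; apply: leqW.
  rewrite exprS in lij; nra.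
have h2 : B - (1 + A * eta) - k%:R * (2 * delta) <= gromov_product D q (p m) (p m.+1).
  have [_ h _] := pl m m.+1 (leqnSn _) jn'.
  have b1 := Bm m im (ltnW mj); have b2 := Bm m.+1 (leqW im) mj.
  have h' : A * (l m.+1 - l m) <= A * eta by apply: ler_wpM2l => //; apply: pe.
  have : 0 <= k%:R * (2 * delta) :> R by rewrite mulr_ge0 ?mulr_ge0.
  rewrite /gromov_product; lra.
have Xs a : (a <= j)%N -> X (p a) by move=> aj; apply: pX; apply: leq_trans jn.
have h12 := hyperbolicP hX Xq (Xs i ij) (Xs m (ltnW mj)) (Xs m.+1 mj) h1 h2.
have h123 : B - (1 + A * eta) - k%:R * (2 * delta) - delta - delta <=
    gromov_product D q (p i) (p j).
  apply: (hyperbolicP hX Xq (Xs i ij) (Xs m.+1 mj) (Xs j (leqnn _))) => //; lra.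
rewrite -natr1; lra.
Qed.


(** With [h] half of [k], squaring [h + 1 <= 2 ^+ h] gives a quadratic lower bound for [2 ^+ k],
    which overtakes the linear term. *)
Lemma linear_lt_exp2 (a b : R) : 0 <= a -> 0 <= b ->
  exists N, forall k, (N <= k)%N -> a + k%:R * b < 2 ^+ k.
Proof.
move=> a0 b0.
pose h0 := (Num.bound (a + 2 * b)).+1.
have h0P : a + 2 * b < h0%:R.
  apply: lt_trans (archi_boundP _) _; first by lra.
  by rewrite ltr_nat.
exists h0.*2 => k hk.
pose h := k./2.
have hh : (h0 <= h)%N by rewrite /h -(doubleK h0) half_leq.
have kle : (k <= h.*2.+1)%N by rewrite -(odd_double_half k); rewrite -/h; case: (odd k) => /=; lia.
have hk2 : (h.*2 <= k)%N by rewrite -(odd_double_half k) leq_addl.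
have e1 : (h.+1)%:R <= 2 ^+ h :> R by rewrite -natrX ler_nat ltn_expl.
have e2 : (h.+1)%:R ^+ 2 <= 2 ^+ k :> R.
  apply: (@le_trans _ _ (2 ^+ h.*2)).
    by rewrite -mul2n mulnC exprM ler_pXn2r ?nnegrE ?exprn_ge0.
  by apply: ler_weXn2l => //; lra.
apply: lt_le_trans e2.
have hR : h0%:R <= h%:R :> R by rewrite ler_nat.
have kR : k%:R <= 2 * h%:R + 1 :> R.
  by move: kle; rewrite -(ler_nat R) -natr1 -mul2n natrM.
have h1 : 1 <= h%:R :> R by rewrite ler1n; apply: leq_trans hh.
have kb : k%:R * b <= (2 * h%:R + 1) * b by apply: ler_wpM2r.
have e3 : h%:R * (a + 2 * b) <= h%:R * h%:R by apply: ler_wpM2l; lra.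
have e4 : a <= h%:R * a by rewrite -[leLHS]mul1r; apply: ler_wpM2r.
rewrite -natr1 expr2; nra.
Qed.

(** The least admissible [k] is about the logarithm of [B], so the hypothesis says [B = O(log B)].
    If that [k] were large, its predecessor would contradict the growth of [2 ^+ k]. *)
Lemma log_bound (A c1 c2 c3 : R) : 0 <= A -> 0 <= c1 -> 0 <= c2 -> 0 <= c3 ->
  exists C, forall B, 0 <= B ->
    (forall k, A * (6 * B + c1) <= 2 ^+ k -> B <= c2 + k%:R * c3) -> B <= C.
Proof.
move=> A0 c10 c20 c30.
have t0 : 0 <= A * (6 * (c2 + c3) + c1) by rewrite mulr_ge0; lra.
have t1 : 0 <= A * (6 * c3) by rewrite !mulr_ge0.
have [N NP] := linear_lt_exp2 t0 t1.
exists (c2 + N%:R * c3) => B B0 H.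
have s0 : 0 <= A * (6 * B + c1) by rewrite mulr_ge0; lra.
have ex : exists k, A * (6 * B + c1) <= 2 ^+ k.
  have [k kP] := linear_lt_exp2 s0 (lexx 0).
  by exists k; have := kP k (leqnn _); rewrite mulr0 addr0 => /ltW.
case: (ex_minnP ex) => k kP mink.
have Bk := H k kP.
have [kN|Nk] := leqP k N.
  apply: le_trans Bk _; rewrite lerD2l ler_wpM2r // ler_nat //.
case: k kP mink Bk Nk => // k kP mink Bk Nk.
have big : 2 ^+ k < A * (6 * B + c1).
  by rewrite ltNge; apply/negP => /mink; rewrite ltnn.
have := NP k Nk.
have : A * (6 * B + c1) <= A * (6 * (c2 + k.+1%:R * c3) + c1).
  by apply: ler_wpM2l => //; lra.
rewrite -natr1; lra.
Qed.

Lemma argmin_nat (f : nat -> R) n :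
  exists2 j, (j <= n)%N & forall i, (i <= n)%N -> f j <= f i.
Proof.
elim: n => [|n [j jn H]]; first by exists 0%N => // i; rewrite leqn0 => /eqP ->.
have [le|lt] := leP (f j) (f n.+1).
  exists j; first exact: leqW.
  by move=> i; rewrite leq_eqVlt => /orP[/eqP -> //|]; rewrite ltnS; apply: H.
exists n.+1 => // i; rewrite leq_eqVlt => /orP[/eqP -> //|]; rewrite ltnS => /H.
by apply: le_trans; apply: ltW.
Qed.

(* This half of the Morse lemma suffices: an almost geodesic stays near every
   quasi-geodesic with the same ends. At the point of the almost geodesic
   farthest from the quasi-geodesic (distance B), step back about 2B on both
   sides; the detour along the quasi-geodesic has length O(B) and avoids the
   ball of radius B, so B = O(log B). *)
Lemma geodesic_near_quasigeodesic X D delta A eps eta :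
  pseudometric X D -> hyperbolic X D delta -> 0 <= delta -> 0 <= A ->
  0 <= eps -> 0 <= eta ->
  exists C, forall p l n g t m,
    quasigeodesic X D A eps eta p l n -> quasigeodesic X D 1 eps eta g t m ->
    g 0%N = p 0%N -> g m = p n ->
    forall i, (i <= m)%N -> exists2 j, (j <= n)%N & D (g i) (p j) <= C.
Proof.
move=> pD hX d0 A0 eps0 eta0.
have Ae : 0 <= A * eta by apply: mulr_ge0.
(* [6 * B + (2 * eta + eps)] will bound the length of the detour. The third constant gathers the
   fixed losses, the last one is the loss per halving. *)
have [|||C CP] := @log_bound A (2 * eta + eps) (1 + A * eta + eps + 2 * delta) (2 * delta) A0;
  [lra|lra|lra|].
exists C => p l n g t m qp qg g0 gm.
have [D0 sD tD] := pD.
have [pX pl pe] := qp; have [gX gt ge] := qg.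
have [j jP] : exists j : nat -> nat, forall i,
    (j i <= n)%N /\ forall k, (k <= n)%N -> D (g i) (p (j i)) <= D (g i) (p k).
  have H i : exists j, (j <= n)%N /\ forall k, (k <= n)%N -> D (g i) (p j) <= D (g i) (p k).
    by have [j jn jmin] := argmin_nat (fun k => D (g i) (p k)) n; exists j.
  by have [j jP] := choice H; exists j.
(* Minimizing the negated distance selects the point [g s] farthest from the quasi-geodesic. *)
have [s sm sP] := argmin_nat (fun i => - D (g i) (p (j i))) m.
pose B := D (g s) (p (j s)).
have BP i : (i <= m)%N -> exists2 k, (k <= n)%N & D (g i) (p k) <= B.
  move=> im; exists (j i); first by case: (jP i).
  by have := sP i im; rewrite lerN2.
have Bmin k : (k <= n)%N -> B <= D (p k) (g s).
  move=> kn; have [jn h] := jP s; rewrite sD //; [exact: h|exact: pX|exact: gX].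
suff BC : B <= C.
  by move=> i im; have [k kn kP] := BP i im; exists k => //; apply: le_trans BC.
have B0 : 0 <= B by apply: (pseudometric_ge0 pD); [exact: gX|apply: pX; case: (jP s)].
have [B0'|Bp] := eqVneq B 0.
  apply: CP => // k _; rewrite B0'; have : 0 <= k%:R * (2 * delta) by rewrite !mulr_ge0.
  lra.
have {}Bp : 0 < B by rewrite lt_neqAle eq_sym Bp.
have Xs : X (g s) by apply: gX.
(* Either [g a] lies at least [2 * B] before [g s], overshooting by at most one step, or it is the
   common starting point. In the first case [p i] is within [B] of [g a] and at least [B] from
   [g s], which makes the Gromov product large; in the second the two points coincide. *)
have left_end : exists a i, [/\ (a <= s)%N, (i <= n)%N, D (g a) (g s) <= 2 * B + eta,
    D (g a) (p i) <= B & B - eps / 2 <= gromov_product D (g s) (g a) (p i)].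
  have [short|long] := ltP (t s - t 0%N) (2 * B).
    exists 0%N, 0%N; have [_ h _] := gt 0%N s (leq0n _) sm.
    have := Bmin 0%N (leq0n _).
    split=> //; rewrite ?g0 /gromov_product ?D0 //.
    - by rewrite -g0; lra.
    - exact: pX.
    - lra.
    - exact: pX.
  have ex : exists k, t s - t k < 2 * B by exists s; lra.
  case: (ex_minnP ex) => -[|k] kP mink; first by lra.
  have ks : (k < s)%N by apply: mink; rewrite subrr; lra.
  have km : (k < m)%N by apply: leq_trans sm.
  have tk : 2 * B <= t s - t k by rewrite leNgt; apply/negP => /mink; rewrite ltnn.
  have [i i_n iB] := BP k (ltnW km).
  have [_ h1 h2] := gt k s (ltnW ks) sm.
  have := ge k km; have := Bmin i i_n.
  by exists k, i; split; rewrite ?(ltnW ks) //; rewrite /gromov_product; lra.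
have right_end : exists a i, [/\ (s <= a)%N /\ (a <= m)%N, (i <= n)%N,
    D (g a) (g s) <= 2 * B + eta,
    D (g a) (p i) <= B & B - eps / 2 <= gromov_product D (g s) (g a) (p i)].
  have [short|long] := ltP (t m - t s) (2 * B).
    exists m, n; have [_ h _] := gt s m sm (leqnn _).
    have := Bmin n (leqnn _).
    have e : D (p n) (g s) = D (g s) (p n) by apply: sD; [exact: pX|].
    have e' : D (p n) (p n) = 0 by apply: D0; exact: pX.
    by move: h; split=> //; rewrite /gromov_product ?gm ?e'; rewrite gm in h; lra.
  have ex : exists k, (s <= k)%N && (2 * B <= t k - t s) by exists m; rewrite sm.
  case: (ex_minnP ex) => k /andP[sk kP] mink.
  have km : (k <= m)%N by apply: mink; rewrite sm.
  have [i i_n iB] := BP k km.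
  have [_ h1 h2] := gt s k sk km.
  have e : D (g k) (g s) = D (g s) (g k) by apply: sD => //; apply: gX.
  have tk : t k - t s <= 2 * B + eta.
    case: k sk kP mink km {i_n iB h1 h2 e} => [|k] sk kP mink km.
      move: sk kP; rewrite leqn0 => /eqP ->; lra.
    move: sk; rewrite leq_eqVlt => /orP[/eqP es|sk]; first by move: kP; rewrite -es; lra.
    have : t k - t s < 2 * B.
      by rewrite ltNge; apply/negP => h; have := mink k; rewrite -ltnS sk h ltnn => /(_ isT).
    have := ge k km; lra.
  have := Bmin i i_n.
  by exists k, i; split; rewrite ?sk ?km //; rewrite /gromov_product; lra.
have [a [i [as_ i_n a1 a2 a3]]] := left_end.
have [b [k [[sb bm] kn b1 b2 b3]]] := right_end.
have Xa : X (g a) by apply: gX; apply: leq_trans sm.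
have Xb : X (g b) by apply: gX.
have Xi : X (p i) by apply: pX.
have Xk : X (p k) by apply: pX.
have pik : D (p i) (p k) <= 6 * B + 2 * eta.
  have h1 := tD _ _ _ Xi Xa Xk; have h2 := tD _ _ _ Xa Xs Xk.
  have h3 := tD _ _ _ Xs Xb Xk.
  rewrite (sD _ _ Xi Xa) in h1; rewrite (sD _ _ Xs Xb) in h3; lra.
(* The point [g s] lies between [g a] and [g b] on an almost geodesic, so this product nearly
   vanishes. The chain [g a], [p i], [p k], [g b] bounds it below by [B] minus a logarithmic
   loss. *)
have ab : gromov_product D (g s) (g a) (g b) <= eps / 2.
  have [_ h1 _] := gt a s as_ sm; have [_ h2 _] := gt s b sb bm.
  have [_ _ h3] := gt a b (leq_trans as_ sb) bm.
  by rewrite /gromov_product (sD (g b) (g s)) //; lra.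
apply: CP => // N NP.
have gik : B - (1 + A * eta) - N%:R * (2 * delta) <= gromov_product D (g s) (p i) (p k).
  have [ik|ki] := leqP i k.
    apply: (exponential_divergence pD hX d0 A0 eta0 qp Xs ik kn) => [c c1 c2|].
      by apply: Bmin; apply: leq_trans kn.
    apply: le_trans NP; apply: ler_wpM2l => //.
    by have [_ _ h] := pl i k ik kn; lra.
  rewrite (gromov_productC (g s) pD Xi Xk).
  apply: (exponential_divergence pD hX d0 A0 eta0 qp Xs (ltnW ki) i_n) => [c c1 c2|].
    by apply: Bmin; apply: leq_trans i_n.
  apply: le_trans NP; apply: ler_wpM2l => //.
  by have [_ _ h] := pl k i (ltnW ki) i_n; rewrite sD // in h; lra.
have N0 : 0 <= N%:R * (2 * delta) by rewrite !mulr_ge0.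
pose B' := B - (1 + A * eta) - N%:R * (2 * delta) - eps / 2.
have u1 : B' <= gromov_product D (g s) (g a) (p i) by rewrite /B'; lra.
have u2 : B' <= gromov_product D (g s) (p i) (p k) by rewrite /B'; lra.
have u3 : B' <= gromov_product D (g s) (p k) (g b).
  by rewrite (gromov_productC (g s) pD Xk Xb) /B'; lra.
have u4 := hyperbolicP hX Xs Xa Xi Xk u1 u2.
have u5 : B' - delta <= gromov_product D (g s) (p k) (g b) by lra.
have := hyperbolicP hX Xs Xa Xk Xb u4 u5.
rewrite /B'; lra.
Qed.

(** Stands in for the existence of geodesics, with additive error [eps] and steps at most [eta]. *)
Definition almost_length_space X D eps eta : Prop :=
  forall x y, X x -> X y -> exists g t m,
    [/\ quasigeodesic X D 1 eps eta g t m, g 0%N = x & g m = y].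

Lemma geodesic_point X D eps eta g t m tau :
  quasigeodesic X D 1 eps eta g t m -> 0 <= eta -> 0 <= tau -> tau <= t m - t 0%N ->
  exists i, [/\ (i <= m)%N, tau <= t i - t 0%N & t i - t 0%N <= tau + eta].
Proof.
move=> [gX gt ge] eta0 tau0 taum.
have ex : exists i, tau <= t i - t 0%N by exists m.
case: (ex_minnP ex) => i iP mini; have im : (i <= m)%N by apply: mini.
exists i; split=> //.
case: i iP mini im => [|i] iP mini im; first by lra.
have : t i - t 0%N < tau by rewrite ltNge; apply/negP => /mini; rewrite ltnn.
have := ge i im; lra.
Qed.

(** A small Gromov product at [z] puts [z] near an almost geodesic joining the two ends, and that
    one stays near the quasi-geodesic. *)
Lemma near_quasigeodesic X D delta A eps eta C :
  pseudometric X D -> hyperbolic X D delta -> 0 <= delta -> 0 <= A ->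
  0 <= eps -> 0 <= eta -> almost_length_space X D eps eta ->
  exists C', forall p l n z, quasigeodesic X D A eps eta p l n -> X z ->
    gromov_product D z (p 0%N) (p n) <= C ->
    exists2 j, (j <= n)%N & D z (p j) <= C'.
Proof.
move=> pD hX d0 A0 eps0 eta0 geo.
have [C0 C0P] := geodesic_near_quasigeodesic pD hX d0 A0 eps0 eta0.
exists (C0 + (2 * delta + C + 3 * eta + 3 * eps)) => p l n z qp Xz gz.
have [D0 sD tD] := pD.
have [pX _ _] := qp.
have Xp0 := pX _ (leq0n n); have Xpn := pX _ (leqnn n).
have [g [t [m [qg g0 gm]]]] := geo _ _ Xp0 Xpn.
have [gX gt ge] := qg.
have e1 := tD _ _ _ Xp0 Xz Xpn; have e2 := tD _ _ _ Xz Xp0 Xpn.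
have e3 := tD _ _ _ Xp0 Xpn Xz.
have s1 := sD _ _ Xz Xp0; have s2 := sD _ _ Xpn Xz.
have s3 := sD _ _ Xz Xpn.
have [_ l1 l2] := gt 0%N m (leq0n _) (leqnn _).
rewrite g0 gm in l1 l2.
(* The Gromov product of [z] and [p n] based at [p 0] locates the point of the almost geodesic
   closest to [z] up to a constant. Clamping at [0] does not change its value, by the triangle
   inequality. *)
pose tau := Num.max 0 (2^-1 * (D z (p 0%N) + D (p 0%N) (p n) - D z (p n))).
have tau0 : 0 <= tau by rewrite le_max lexx.
have tauE : tau = 2^-1 * (D z (p 0%N) + D (p 0%N) (p n) - D z (p n)).
  by rewrite /tau; apply: max_r; lra.
have [|i [im i1 i2]] := geodesic_point qg eta0 tau0; first by rewrite tauE; lra.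
have [k kn kC] := C0P p l n g t m qp qg g0 gm i im.
exists k => //.
have Xi : X (g i) by apply: gX.
have Xk : X (p k) by apply: pX.
have := tD _ _ _ Xz Xi Xk.
suff : D z (g i) <= 2 * delta + C + 3 * eta + 3 * eps by lra.
have [_ r1 r2] := gt 0%N i (leq0n _) im; have [_ r3 r4] := gt i m im (leqnn _).
rewrite g0 in r1 r2; rewrite gm in r3 r4.
have f1 := sD _ _ Xi Xpn; have f2 := sD _ _ Xi Xp0; have f3 := sD _ _ Xi Xz.
(* Based at [g i], the product of the two ends is almost [0], so the product of [z] with one of them
   is bounded; by the choice of [tau], either bound controls [D z (g i)]. *)
have := hX (g i) (p 0%N) z (p n) Xi Xp0 Xz Xpn.
move: gz; rewrite /gromov_product.
rewrite lerBlDr ge_min => gz /orP[]; lra.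
Qed.

End QuasiGeodesics.

(** * Discs and chains *)
Section Norms.
Context {R : realType}.
Implicit Types (z w : R[i]) (t s : R).

Lemma normC_cabs z : `|z| = (cabs z)%:C%C.
Proof. by rewrite /cabs RRe_real // normr_real. Qed.

Lemma cabs_ge0 z : 0 <= cabs z.
Proof. by rewrite -lecR -normC_cabs normr_ge0. Qed.

Lemma cabs_real t : cabs t%:C%C = `|t|.
Proof. by rewrite /cabs normc_def /= expr0n addr0 sqrtr_sqr. Qed.

Lemma cabsM z w : cabs (z * w) = cabs z * cabs w.
Proof. by apply: complexI; rewrite rmorphM /= -!normC_cabs normrM. Qed.

Lemma cabsV z : cabs z^-1 = (cabs z)^-1.
Proof. by apply: complexI; rewrite fmorphV /= -!normC_cabs normfV. Qed.

Lemma cabsN z : cabs (- z) = cabs z.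
Proof. by rewrite /cabs normrN. Qed.

Lemma cabs_conj z : cabs z^* = cabs z.
Proof. by rewrite /cabs norm_conjC. Qed.

Lemma cabs_lt1 z : (cabs z < 1) = (`|z| < 1).
Proof. by rewrite -ltcR normC_cabs. Qed.

Context {d : nat}.
Implicit Types (x y : Cd R d).

Lemma norm_nrm x : `|x| = (nrm x)%:C%C.
Proof. by rewrite /nrm RRe_real // normr_real. Qed.

Lemma nrm_ge0 x : 0 <= nrm x.
Proof. by rewrite -lecR -norm_nrm normr_ge0. Qed.

Lemma nrm0 : nrm (0 : Cd R d) = 0.
Proof. by rewrite /nrm normr0. Qed.

Lemma nrm_eq0 x : (nrm x == 0) = (x == 0).
Proof. by rewrite -(inj_eq (@complexI R)) -norm_nrm normr_eq0. Qed.

Lemma nrmN x : nrm (- x) = nrm x.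
Proof. by rewrite /nrm normrN. Qed.

Lemma nrmD x y : nrm (x + y) <= nrm x + nrm y.
Proof. by rewrite -lecR rmorphD /= -!norm_nrm ler_normD. Qed.

Lemma nrm_distC x y : nrm (x - y) = nrm (y - x).
Proof. by rewrite -nrmN opprB. Qed.

Lemma nrm_triangle y x v : nrm (x - v) <= nrm (x - y) + nrm (y - v).
Proof. by have := nrmD (x - y) (y - v); rewrite addrA subrK. Qed.

Lemma nrmZ (a : R[i]) x : nrm (a *: x) = cabs a * nrm x.
Proof. by apply: complexI; rewrite rmorphM /= -normC_cabs -!norm_nrm normrZ. Qed.

Lemma nbhs_eball x (A : set (Cd R d)) :
  nbhs x A <-> exists2 r : R, 0 < r & eball x r `<=` A.
Proof.
split=> [/nbhs_ballP[e /= e0 eA]|[r r0 rA]].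
  have er : e \is Num.real by rewrite realE ltW.
  exists (complex.Re e); first by rewrite -ltcR RRe_real.
  move=> w wr; apply: eA; rewrite -ball_normE /= distrC norm_nrm.
  by rewrite -(RRe_real er) ltcR.
apply/nbhs_ballP; exists r%:C%C; first by rewrite /= ltcR.
move=> w; rewrite -ball_normE /= distrC norm_nrm ltcR; exact: rA.
Qed.

Lemma open_eball x (A : set (Cd R d)) : open A -> A x ->
  exists2 r : R, 0 < r & eball x r `<=` A.
Proof. by move=> oA Ax; apply/nbhs_eball; apply: open_nbhs_nbhs. Qed.

Lemma closure_eball x (A : set (Cd R d)) :
  closure A x <-> forall r : R, 0 < r -> exists2 z, A z & eball x r z.
Proof.
split=> [cA r r0|H B /nbhs_eball[r r0 rB]].
  have [|z [Az zB]] := cA (eball x r); first by apply/nbhs_eball; exists r.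
  by exists z.
by have [z Az zr] := H r r0; exists z; split => //; apply: rB.
Qed.

End Norms.

(* Over an abstract field K, because unification diverges at K = R[i]. *)
Section ComplexDerivatives.
Context {K : numFieldType} {V : normedModType K}.

Lemma derivable_homography (a c e z : K) : 1 + c * (e * z) != 0 ->
  derivable (fun z : K^o => ((e * z + a) / (1 + c * (e * z)) : K^o)) z 1.
Proof.
move=> den.
have lin (k l : K) : derivable (fun z : K^o => (k * z + l : K^o)) z 1.
  apply: derivableD; last exact: derivable_cst.
  by apply: derivableM => //; exact: derivable_cst.
apply: derivableM; first exact: lin.
by apply: derivableV.
Qed.

Lemma derivable_disc_comp (f : K^o -> V) (h : K^o -> K^o) z :
  derivable h z 1 -> derivable f (h z) 1 -> derivable (f \o h) z 1.
Proof.
move=> dh df; apply: diff_derivable; apply: differentiable_comp.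
  exact/derivable1_diffP.
exact/derivable1_diffP.
Qed.

Lemma derivable_line (c v : V) (z : K) : derivable (fun u : K^o => c + u *: v) z 1.
Proof.
apply: derivableD; first exact: derivable_cst.
by apply/derivable1_diffP; exact: differentiableZl.
Qed.

Lemma derivable_disc_continuous (f : K^o -> V) (z : K^o) :
  derivable f z 1 -> {for z, continuous f}.
Proof. by move=> df; apply: differentiable_continuous; apply/derivable1_diffP. Qed.

End ComplexDerivatives.

(** * Hyperbolic geometry of the unit disc *)

Section Links.
Context {R : realType}.
Implicit Types (t s : R).

Definition artanh t : R := 2^-1 * ln ((1 + t) / (1 - t)).

Lemma artanh0 : artanh 0 = 0.
Proof. by rewrite /artanh addr0 subr0 divr1 ln1 mulr0. Qed.

(** Makes hyperbolic length additive along a radius: the argument on the left is the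
    pseudo-hyperbolic distance of the real points [t1] and [t]. *)
Lemma artanh_sub t t1 : 0 <= t1 -> t1 <= t -> t < 1 ->
  artanh ((t - t1) / (1 - t1 * t)) = artanh t - artanh t1.
Proof.
move=> t10 tt1 t_lt1.
have tt : 0 < 1 - t1 * t by nra.
rewrite /artanh -mulrBr -ln_div ?posrE ?divr_gt0 //; try by lra.
congr (_ * ln _); field.
have h : 0 < (1 - t) * (1 + t1) by rewrite mulr_gt0; lra.
by repeat (apply/andP; split); apply/negP => /eqP; nra.
Qed.

Lemma artanh_ge0 t : 0 <= t -> t < 1 -> 0 <= artanh t.
Proof.
move=> t0 t1; rewrite mulr_ge0 // ln_ge0 // ler_pdivlMr; lra.
Qed.

Lemma artanh_le t : 0 <= t -> t <= 2^-1 -> artanh t <= 2 * t.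
Proof.
move=> t0 t1; rewrite /artanh (_ : (1 + t) / (1 - t) = 1 + 2 * t / (1 - t)).
  have h : 2 * t / (1 - t) <= 4 * t by rewrite ler_pdivrMr; nra.
  have := @le_ln1Dx R (2 * t / (1 - t)).
  have : 0 <= 2 * t / (1 - t) by rewrite divr_ge0 //; lra.
  move=> h0 /(_ ltac:(lra)); lra.
field; lra.
Qed.

Lemma artanh_surj s : 0 <= s -> exists t, [/\ 0 <= t, t < 1 & artanh t = s].
Proof.
move=> s0; set e := expR (2 * s).
have e1 : 1 <= e by rewrite -expR0 ler_expR; lra.
exists ((e - 1) / (e + 1)); split.
- by rewrite divr_ge0 //; lra.
- by rewrite ltr_pdivrMr; lra.
- rewrite /artanh (_ : _ / _ = e) ?expRK; first by lra.
  by field; repeat (apply/andP; split); lra.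
Qed.

Lemma artanh_ge t : 0 <= t -> t < 1 -> t <= 2 * artanh t.
Proof.
move=> t0 t1.
have h : ln ((1 - t) / (1 + t)) <= - (2 * t) / (1 + t).
  rewrite (_ : (1 - t) / (1 + t) = 1 + - (2 * t) / (1 + t)); last by field; lra.
  apply: le_ln1Dx; rewrite -subr_gt0.
  rewrite (_ : _ - _ = (1 - t) / (1 + t) + 1 - 1); last by field; lra.
  by rewrite addrK divr_gt0 //; lra.
have e : ln ((1 + t) / (1 - t)) = - ln ((1 - t) / (1 + t)).
  by rewrite -lnV ?posrE ?divr_gt0 ?invf_div //; lra.
have h2 : t <= 2 * t / (1 + t) by rewrite ler_pdivlMr; nra.
rewrite mulNr in h.
rewrite /artanh e; lra.
Qed.

Lemma artanh_mono t t' : 0 <= t -> t < t' -> t' < 1 -> artanh t < artanh t'.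
Proof.
move=> t0 tt' t'1; rewrite -subr_gt0 -artanh_sub ?(ltW tt') //.
have d0 : 0 < 1 - t * t' by nra.
have v0 : 0 < (t' - t) / (1 - t * t') by rewrite divr_gt0 // subr_gt0.
have v1 : (t' - t) / (1 - t * t') < 1 by rewrite ltr_pdivrMr; nra.
have := artanh_ge (ltW v0) v1; lra.
Qed.

Lemma poincare_real t1 t : 0 <= t1 -> t1 <= t -> t < 1 ->
  poincare t1%:C%C t%:C%C = artanh t - artanh t1.
Proof.
move=> t10 tt1 t_lt1; rewrite -artanh_sub // /poincare.
have -> : (t1%:C%C)^* = t1%:C%C by apply: conj_Creal; apply/complex_realP; exists t1.
rewrite -rmorphB -rmorphM -(rmorph1 (real_complex R)) -rmorphB -fmorphV -rmorphM /=.
have -> : cabs (((t1 - t) / (1 - t1 * t))%:C)%C = (t - t1) / (1 - t1 * t).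
  have den : 0 <= (1 - t1 * t)^-1 by rewrite invr_ge0; nra.
  by rewrite cabs_real normrM (ger0_norm den) distrC ger0_norm //; lra.
by [].
Qed.

Lemma poincareC (a b : R[i]) : poincare a b = poincare b a.
Proof.
rewrite /poincare (_ : cabs _ = cabs ((b - a) / (1 - b^* * a))) //.
rewrite !cabsM !cabsV -(cabsN (a - b)) opprB; congr (_ / _).
by rewrite -(cabs_conj (1 - _)) rmorphB rmorph1 rmorphM /= conjCK mulrC.
Qed.

(** The automorphism of the disc that carries [0] to [a]; its inverse is [mobius (- a)]. *)
Definition mobius (a z : R[i]) : R[i] := (z + a) / (1 + a^* * z).

Lemma mobius_den (a z : R[i]) : cabs a < 1 -> cabs z < 1 -> 1 + a^* * z != 0.
Proof.
move=> a1 z1; apply/eqP => h.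
have : cabs (a^* * z) = 1.
  have -> : a^* * z = - 1 by apply/eqP; rewrite -subr_eq0 opprK addrC h.
  by rewrite cabsN /cabs normr1.
rewrite cabsM cabs_conj; have := cabs_ge0 a; have := cabs_ge0 z; nra.
Qed.

Lemma mobius_disc (a z : R[i]) : cabs a < 1 -> cabs z < 1 -> cabs (mobius a z) < 1.
Proof.
move=> a1 z1; have den := mobius_den a1 z1.
rewrite cabs_lt1 /mobius normrM normfV ltr_pdivrMr ?normr_gt0 // mul1r.
rewrite -(@ltr_pXn2r _ 2) ?nnegrE ?normr_ge0 // -subr_gt0.
have -> : `|1 + a^* * z| ^+ 2 - `|z + a| ^+ 2 = (1 - `|a| ^+ 2) * (1 - `|z| ^+ 2).
  by rewrite !normCK !rmorphD rmorph1 rmorphM /= conjCK; ring.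
by rewrite mulr_gt0 // subr_gt0 expr_lt1 ?normr_ge0 // -cabs_lt1.
Qed.

Lemma mobius_inv (a b : R[i]) : cabs a < 1 -> cabs b < 1 ->
  cabs ((b - a) / (1 - a^* * b)) < 1 /\ mobius a ((b - a) / (1 - a^* * b)) = b.
Proof.
move=> a1 b1.
have a1' : cabs (- a) < 1 by rewrite cabsN.
have e : (b - a) / (1 - a^* * b) = mobius (- a) b.
  by rewrite /mobius rmorphN mulNr.
split; first by rewrite e; apply: mobius_disc.
have d1 : 1 - a^* * b != 0 by have := mobius_den a1' b1; rewrite rmorphN mulNr.
have d2 : 1 - a^* * a != 0 by have := mobius_den a1' a1; rewrite rmorphN mulNr.
rewrite /mobius; field; rewrite d1 /=.
by rewrite (_ : _ + _ = 1 - a^* * a) //; ring.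
Qed.

Lemma derivable_mobius (a u z : R[i]) : cabs a < 1 -> cabs (u * z) < 1 ->
  derivable (fun z : Cplx R => (mobius a (u * z) : Cplx R)) z 1.
Proof.
move=> a1 z1; by apply: derivable_homography; exact: mobius_den.
Qed.

End Links.

(** * Chains of holomorphic discs *)

Section Chains.
Context {R : realType} {d : nat}.
Implicit Types (Om : set (Cd R d)) (x y z w : Cd R d) (s t eta eps : R).

(** One disc of a Kobayashi chain, normalized to run along the radius from [0] to [t], so that it
    can be cut at any intermediate length. *)
Definition link Om z w s : Prop :=
  exists (g : Cplx R -> Cd R d) t,
    [/\ holo_disc Om g, 0 <= t < 1, g 0 = z, g t%:C%C = w & s = artanh t].

Lemma cabs0 : cabs (0 : R[i]) = 0.
Proof. by rewrite /cabs normr0. Qed.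

Lemma holo_comp Om (f : Cplx R -> Cd R d) (h : Cplx R -> Cplx R) :
  holo_disc Om f ->
  (forall u : Cplx R, cabs u < 1 -> derivable h u 1 /\ cabs (h u) < 1) ->
  holo_disc Om (f \o h).
Proof.
move=> hf hh z z1; have [dh h1] := hh z z1; have [df Of] := hf _ h1.
by split; [exact (@derivable_disc_comp R[i] 'rV[R[i]^o]_d f h z dh df)|].
Qed.

(** Precompose with the automorphism that carries [0] to [a] and with a rotation [u] that makes the
    preimage of [b] real and nonnegative. *)
Lemma disc_link Om (f : Cplx R -> Cd R d) (a b : R[i]) : holo_disc Om f ->
  cabs a < 1 -> cabs b < 1 -> link Om (f a) (f b) (poincare a b).
Proof.
move=> hf a1 b1; have [c1 cb] := mobius_inv a1 b1.
set c := (b - a) / _ in c1 cb.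
pose u : R[i] := if c == 0 then 1 else c / `|c|.
have u1 : cabs u = 1.
  rewrite /u; have [_|c0] := eqVneq c 0; first by rewrite /cabs normr1.
  by rewrite /cabs normrM normfV normr_id divff ?normr_eq0.
have ut : u * (cabs c)%:C%C = c.
  rewrite -normC_cabs /u; have [->|c0] := eqVneq c 0; first by rewrite normr0 mulr0.
  by rewrite divfK ?normr_eq0.
exists (f \o (fun z : Cplx R => mobius a (u * z))), (cabs c); split.
- apply: (holo_comp hf) => z z1.
  have uz : cabs (u * z) < 1 by rewrite cabsM u1 mul1r.
  by split; [exact: derivable_mobius|exact: mobius_disc].
- by rewrite cabs_ge0.
- by rewrite /= /mobius !mulr0 add0r addr0 divr1.
- by rewrite /= ut cb.
- rewrite /poincare /artanh (_ : cabs ((a - b) / _) = cabs c) //.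
  by rewrite /c !cabsM -(cabsN (a - b)) opprB.
Qed.

Lemma cabs_lt1_real t : 0 <= t < 1 -> cabs t%:C%C < 1.
Proof. by move=> /andP[t0 t1]; rewrite cabs_real ger0_norm. Qed.

Lemma link_sub Om (g : Cplx R -> Cd R d) t1 t : holo_disc Om g ->
  0 <= t1 -> t1 <= t -> t < 1 -> link Om (g t1%:C%C) (g t%:C%C) (artanh t - artanh t1).
Proof.
move=> hg t10 tt1 t_lt1; rewrite -poincare_real //.
by apply: disc_link => //; apply: cabs_lt1_real; apply/andP; split; lra.
Qed.

Lemma link_ge0 Om z w s : link Om z w s -> 0 <= s.
Proof. by move=> [g [t [_ /andP[t0 t1] _ _ ->]]]; apply: artanh_ge0. Qed.

Lemma link_inr Om z w s : link Om z w s -> Om w.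
Proof.
by move=> [g [t [hg t1 _ <- _]]]; have [|] := hg t%:C%C; first exact: cabs_lt1_real.
Qed.

Lemma link_sym Om z w s : link Om z w s -> link Om w z s.
Proof.
move=> [g [t [hg t1 <- <- ->]]]; have /andP[t0 t_lt1] := t1.
have -> : artanh t = poincare t%:C%C 0.
  by rewrite poincareC -(rmorph0 (real_complex R)) poincare_real // artanh0 subr0.
by apply: disc_link; rewrite ?cabs0 ?cabs_lt1_real.
Qed.

Lemma link_subset Om Om' z w s : Om `<=` Om' -> link Om z w s -> link Om' z w s.
Proof.
move=> sub [g [t [hg t1 gz gw es]]]; exists g, t; split=> // u u1.
by have [du Ou] := hg u u1; split=> //; apply: sub.
Qed.

Lemma link_split Om z w s s1 : link Om z w s -> 0 <= s1 -> s1 <= s ->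
  exists m, link Om z m s1 /\ link Om m w (s - s1).
Proof.
move=> [g [t [hg /andP[t0 t1] gz gw es]]] s10 ss1.
have [u [u0 u1 us]] := artanh_surj s10.
have ut : u <= t.
  by rewrite leNgt; apply/negP => tu; have := artanh_mono t0 tu u1; lra.
exists (g u%:C%C); split.
  by exists g, u; rewrite u0 u1.
by rewrite -gw es -us; apply: link_sub.
Qed.

Lemma disc_continuous Om (g : Cplx R -> Cd R d) (a : R[i]) : holo_disc Om g ->
  cabs a < 1 -> forall eps, 0 < eps -> exists2 r : R, 0 < r &
    forall b, cabs (b - a) < r -> nrm (g b - g a) < eps.
Proof.
move=> hg a1 eps e0; have [dg _] := hg a a1.
have cg : {for a, continuous g}.
  exact (@derivable_disc_continuous R[i] 'rV[R[i]^o]_d g a dg).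
have /nbhs_ballP[e /= e_gt0 eb] : nbhs (a : Cplx R) (g @^-1` eball (g a) eps).
  by apply: cg; apply/nbhs_eball; exists eps.
have er : e \is Num.real by rewrite realE ltW.
exists (complex.Re e); first by rewrite -ltcR RRe_real.
move=> b ba; apply: eb; rewrite -ball_normE /= distrC normC_cabs.
by rewrite -(RRe_real er) ltcR.
Qed.

(** The intermediate value theorem, applied to the distance from [x] along the image of the
    radius. *)
Lemma link_cross Om z w s x rho : link Om z w s ->
  nrm (z - x) <= rho -> rho <= nrm (w - x) ->
  exists m s1, [/\ 0 <= s1 <= s, link Om z m s1, link Om m w (s - s1) & nrm (m - x) = rho].
Proof.
move=> [g [t [hg /andP[t0 t1] gz gw es]]] zr wr.
pose f (u : R) := nrm (g u%:C%C - x).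
have cf : {within `[0, t], continuous f}.
  apply: continuous_in_subspaceT => u; rewrite inE /= in_itv /= => /andP[u0 ut].
  apply/cvgrPdist_lt => eps e0.
  have u1 : cabs u%:C%C < 1 by apply: cabs_lt1_real; lra.
  have [r r0 rP] := disc_continuous hg u1 e0.
  apply/nbhs_ballP; exists r => // v; rewrite /ball /= => uv.
  have := rP v%:C%C; rewrite -rmorphB /= cabs_real distrC => /(_ uv) h.
  rewrite /f ltr_norml; have := nrm_triangle (g u%:C%C) (g v%:C%C) x.
  have := nrm_triangle (g v%:C%C) (g u%:C%C) x.
  have a0 := nrm_distC (g u%:C%C) (g v%:C%C).
  by move=> a1 a2; apply/andP; split; lra.
have f0 : f 0 = nrm (z - x) by rewrite /f rmorph0 gz.
have ft : f t = nrm (w - x) by rewrite /f gw.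
have [|u] := IVT t0 cf (_ : Num.min (f 0) (f t) <= rho <= Num.max (f 0) (f t)).
  by rewrite ge_min le_max f0 ft zr wr orbT.
rewrite in_itv /= => /andP[u0 ut] fu.
exists (g u%:C%C), (artanh u); split=> //.
- rewrite artanh_ge0 //=; last lra.
  by have := link_ge0 (link_sub hg u0 ut t1); rewrite es; lra.
- by exists g, u; rewrite u0 /=; split=> //; lra.
- by rewrite es -gw; apply: link_sub.
Qed.

(** Lengths are stored as increments of a cumulative [l], so subchains and quasi-geodesics can be
    read off from the same data. *)
Definition chain Om eta z w s : Prop :=
  exists n (p : nat -> Cd R d) (l : nat -> R),
    [/\ p 0%N = z, p n = w, l n - l 0%N = s
      & forall i, (i < n)%N ->
          link Om (p i) (p i.+1) (l i.+1 - l i) /\ l i.+1 - l i <= eta].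

Lemma chain0 Om eta z : chain Om eta z z 0.
Proof. by exists 0%N, (fun=> z), (fun=> 0); split=> //; rewrite subrr. Qed.

Lemma chain_link Om eta z w s : link Om z w s -> s <= eta -> chain Om eta z w s.
Proof.
move=> zw se; exists 1%N, (fun i => if i is 0%N then z else w), (fun i => if i is 0%N then 0 else s).
by split; rewrite ?subr0 // => -[|i] //= _; rewrite subr0.
Qed.

Lemma chain_cat Om eta z y w s s' :
  chain Om eta z y s -> chain Om eta y w s' -> chain Om eta z w (s + s').
Proof.
move=> [n [p [l [p0 pn ln H]]]] [n' [p' [l' [p'0 p'n l'n H']]]].
exists (n + n')%N, (fun i => if (i <= n)%N then p i else p' (i - n)%N),
  (fun i => if (i <= n)%N then l i else l n + l' (i - n)%N - l' 0%N); split=> //.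
- case: n' p'n l'n H' => [|n'] p'n l'n H'; first by rewrite addn0 leqnn pn -p'0.
  by rewrite ifF; [rewrite addKn|apply/negbTE; rewrite -ltnNge; lia].
- case: n' p'n l'n H' => [|n'] p'n l'n H'; first by rewrite addn0 leqnn /=; lra.
  rewrite ifF; last by apply/negbTE; rewrite -ltnNge; lia.
  by rewrite addKn /=; lra.
- move=> i; case: (ltngtP i n) => [i_n|n_i|->] i_lt.
  + by have := H i i_n; rewrite ?i_n ?(ltnW i_n).
  + rewrite subSn; last by apply: ltnW.
    have -> : l n + l' (i - n).+1 - l' 0%N - (l n + l' (i - n)%N - l' 0%N) =
      l' (i - n).+1 - l' (i - n)%N by lra.
    by apply: H'; lia.
  + rewrite subSnn; have -> : l n + l' 1%N - l' 0%N - l n = l' 1%N - l' 0%N by lra.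
    by rewrite pn -p'0; apply: H'; lia.
Qed.

Lemma chain_refine Om eta z w s : 0 < eta -> link Om z w s -> chain Om eta z w s.
Proof.
move=> eta0 zw.
have [N Ns] : exists N : nat, s <= N%:R * eta.
  exists (Num.bound (s / eta)); rewrite -ler_pdivrMr //.
  by apply: ltW; apply: archi_boundP; rewrite divr_ge0 ?(link_ge0 zw) // ltW.
elim: N z w s zw Ns => [|N IH] z w s zw Ns.
  by apply: chain_link => //; lra.
have [se|es] := leP s eta; first exact: chain_link.
have [m [zm mw]] := link_split zw (ltW eta0) (ltW es).
rewrite -(subrK eta s) addrC; apply: chain_cat (chain_link zm (lexx _)) _.
by apply: IH => //; move: Ns; rewrite -natr1; lra.
Qed.

Lemma chain_kob_lengths Om eta z w s : chain Om eta z w s -> kob_chain_lengths Om z w s.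
Proof.
move=> [n [p [l [p0 pn ln H]]]].
have /choice[F FP] i : exists gt : (Cplx R -> Cd R d) * R, (i < n)%N ->
    [/\ holo_disc Om gt.1, 0 <= gt.2 < 1, gt.1 0 = p i, gt.1 gt.2%:C%C = p i.+1
      & l i.+1 - l i = artanh gt.2].
  have [i_n|n_i] := ltnP i n; last by exists (fun=> 0, 0).
  by have [[g [t gt]] _] := H i i_n; exists (g, t).
exists n, p, (fun i => (F i).1), (fun=> 0), (fun i => ((F i).2)%:C%C); split=> //.
  move=> j jn; have [h t1 g0 gt _] := FP j jn.
  by split; rewrite ?cabs0 ?cabs_lt1_real.
rewrite -ln -(telescope_sumr l (leq0n n)) big_mkord; apply: eq_bigr => i _.
have [_ /andP[t0 t1] _ _ ->] := FP i (ltn_ord i).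
by rewrite -(rmorph0 (real_complex R)) poincare_real // artanh0 subr0.
Qed.

(** Discs can be subdivided without changing the total length, so [kob] is also an infimum over
    chains with arbitrarily short links. This yields discrete almost geodesics with small steps. *)
Lemma kob_lengths_chain Om eta z w s : 0 < eta ->
  kob_chain_lengths Om z w s -> chain Om eta z w s.
Proof.
move=> eta0 [n [p [f [a [b [<- <- H ->]]]]]].
elim: n H => [|n IH] H; first by rewrite big_ord0; apply: chain0.
rewrite big_ord_recr /=; apply: (chain_cat (y := p n)).
  by apply: IH => j jn; apply: H; apply: ltnW.
apply: chain_refine => //.
by have [hf a1 b1 <- <-] := H n (ltnSn n); apply: disc_link.
Qed.

Lemma chain_sym Om eta z w s : chain Om eta z w s -> chain Om eta w z s.
Proof.
move=> [n [p [l [<- <- <- H]]]].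
elim: n H => [|n IH] H; first by rewrite subrr; apply: chain0.
have [h1 h2] := H n (ltnSn n).
have -> : l n.+1 - l 0%N = (l n.+1 - l n) + (l n - l 0%N) by lra.
apply: chain_cat (chain_link (link_sym h1) h2) _.
by apply: IH => j jn; apply: H; apply: ltnW.
Qed.

Lemma chain_ge0 Om eta z w s : chain Om eta z w s -> 0 <= s.
Proof.
move=> [n [p [l [_ _ <- H]]]].
elim: n H => [|n IH] H; first by rewrite subrr.
have [/link_ge0 h1 _] := H n (ltnSn n).
have := IH (fun j jn => H j (ltnW jn)); lra.
Qed.

Lemma chain_in Om eta z w s : chain Om eta z w s -> Om z -> Om w.
Proof.
move=> [n [p [l [<- <- _ H]]]]; case: n H => [|n] H // _.
by have [/link_inr] := H n (ltnSn n).
Qed.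

Lemma chain_subset Om Om' eta z w s : Om `<=` Om' ->
  chain Om eta z w s -> chain Om' eta z w s.
Proof.
move=> sub [n [p [l [p0 pn ln H]]]]; exists n, p, l; split=> // i i_n.
by have [h1 h2] := H i i_n; split=> //; apply: link_subset h1.
Qed.

Lemma kob_lengths_lbound Om z w : lbound (kob_chain_lengths Om z w) 0.
Proof. by move=> s /(kob_lengths_chain ltr01)/chain_ge0. Qed.

Lemma kob_le Om eta z w s : chain Om eta z w s -> kob Om z w <= s.
Proof.
move=> /chain_kob_lengths h; apply: ge_inf => //.
by exists 0; apply: kob_lengths_lbound.
Qed.

Lemma kob_le_link Om z w s : link Om z w s -> kob Om z w <= s.
Proof. by move=> /chain_link/(_ (lexx _)) => /kob_le. Qed.

Lemma kobC Om z w : kob Om z w = kob Om w z.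
Proof.
rewrite /kob; congr inf; apply/seteqP; split=> s /(kob_lengths_chain ltr01)/chain_sym;
  exact: chain_kob_lengths.
Qed.

Lemma kob_ge0 Om z w : 0 <= kob Om z w.
Proof.
have [ne|e] := pselect (kob_chain_lengths Om z w !=set0).
  by apply: lb_le_inf => //; exact: kob_lengths_lbound.
(* Without any chain, [kob] is the infimum of the empty set, which is [0] by convention. *)
by rewrite /kob (_ : kob_chain_lengths _ _ _ = set0) ?inf0 //; apply: contrapT => /eqP/set0P.
Qed.

Lemma kobxx Om z : kob Om z z = 0.
Proof.
by apply/le_anti; rewrite kob_ge0 (kob_le (eta := 0) (chain0 _ _ _)).
Qed.

Lemma disc_to_ball (c v : Cd R d) Om r : 0 < r -> eball c r `<=` Om ->
  nrm (v - c) < r / 2 -> link Om c v (artanh (nrm (v - c) / r)).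
Proof.
move=> r0 rOm vr.
have v0 := nrm_ge0 (v - c).
have t01 : 0 <= nrm (v - c) / r < 1.
  by rewrite divr_ge0 ?(ltW r0) //= ltr_pdivrMr //; lra.
(* For [v = c] there is no direction and the constant disc serves; otherwise take the affine disc of
   radius [r] centred at [c] in the direction of [v - c]. *)
have [vc|vc] := eqVneq (nrm (v - c)) 0.
  have /eqP : v - c == 0 by rewrite -nrm_eq0 vc.
  move=> /eqP; rewrite subr_eq0 => /eqP ->.
  exists (fun=> c), 0; rewrite lexx ltr01 subrr nrm0 mul0r; split=> // u u1.
  by split; [exact (@derivable_cst R[i] R[i]^o 'rV[R[i]^o]_d c u 1)|apply: rOm; rewrite /eball /= subrr nrm0].
pose k := (r / nrm (v - c))%:C%C.
exists (fun u : Cplx R => c + u *: (k *: (v - c))), (nrm (v - c) / r); split=> //.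
- move=> u u1; split.
    exact (@derivable_line R[i] 'rV[R[i]^o]_d c (k *: (v - c)) u).
  apply: rOm; rewrite /eball /= addrC addKr !nrmZ cabs_real ger0_norm; last by rewrite divr_ge0 // ltW.
  by rewrite divfK // -[ltRHS]mul1r ltr_pM2r.
- by rewrite scale0r addr0.
- rewrite scalerA -rmorphM /= mulrA divfK ?gt_eqF // divff // scale1r addrC subrK //.
Qed.

Lemma kob_ball Om c v r : 0 < r -> eball c r `<=` Om -> nrm (v - c) < r / 2 ->
  kob Om c v <= 2 * (nrm (v - c) / r).
Proof.
move=> r0 rOm vr; apply: le_trans (kob_le_link (disc_to_ball r0 rOm vr)) _.
apply: artanh_le; first by rewrite divr_ge0 ?nrm_ge0 // ltW.
by rewrite ler_pdivrMr //; lra.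
Qed.

(** The set of points reachable from [z] is open and closed in [Om], because small balls are reached
    by affine discs. *)
Lemma open_chain_connected Om z w : open Om -> connected Om -> Om z -> Om w ->
  exists s, chain Om 1 z w s.
Proof.
move=> oO cO Oz Ow.
pose A := [set y | Om y /\ exists s, chain Om 1 z y s].
have near y : Om y -> exists2 r, 0 < r & forall v, nrm (v - y) < r ->
    Om v /\ exists s, chain Om 1 y v s.
  move=> Oy; have [r r0 rO] := open_eball oO Oy; exists (r / 2); first lra.
  move=> v vr; split; first by apply: rO; rewrite /eball /=; lra.
  exists (artanh (nrm (v - y) / r)).
  by apply: chain_refine => //; apply: disc_to_ball.
suff OA : Om = A by have [_] : A w by rewrite -OA.
have AO : A `<=` Om by move=> y [].
apply/esym/cO => //.
- by exists z; split=> //; exists 0; exact: chain0.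
- exists (A : set (Cd R d)); last by apply/seteqP; split=> y; [move=> Ay; split; [exact: AO|]|case].
  rewrite openE => y [Oy [s zs]]; apply/nbhs_eball.
  have [r r0 rP] := near y Oy; exists r => // v vr.
  by have [Ov [s' ys']] := rP v vr; split=> //; exists (s + s'); exact: chain_cat ys'.
- exists (closure A); first exact: closed_closure.
  apply/seteqP; split=> y; first by move=> Ay; split; [exact: AO|exact: subset_closure].
  move=> [Oy cAy]; split=> //; have [r r0 rP] := near y Oy.
  have /closure_eball/(_ r r0)[v [Ov [s zs]] vr] := cAy.
  have [_ [s' ys']] := rP v vr.
  by exists (s + s'); exact: chain_cat (chain_sym ys').
Qed.

End Chains.

(** * The Kobayashi distance of a domain *)
Section KobayashiDomain.
Context {R : realType} {d : nat}.
Implicit Types (Om V : set (Cd R d)) (x y z w a b m : Cd R d) (s t eta eps r rho : R).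

Lemma kob_approx Om eta eps z w : domain Om -> Om z -> Om w -> 0 < eta -> 0 < eps ->
  exists2 s, chain Om eta z w s & s < kob Om z w + eps.
Proof.
move=> [oO cO _] Oz Ow eta0 eps0.
have [s zw] := open_chain_connected oO cO Oz Ow.
have hi : has_inf (kob_chain_lengths Om z w).
  split; first by exists s; exact: chain_kob_lengths zw.
  by exists 0; exact: kob_lengths_lbound.
have [t /(kob_lengths_chain eta0) zwt tl] := inf_adherent eps0 hi.
by exists t.
Qed.

Lemma kob_triangle Om y z w : domain Om -> Om z -> Om y -> Om w ->
  kob Om z w <= kob Om z y + kob Om y w.
Proof.
move=> dO Oz Oy Ow; apply/ler_addgt0Pr => e e0.
have e20 : 0 < e / 2 by lra.
have [s zy hs] := kob_approx dO Oz Oy ltr01 e20.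
have [t yw ht] := kob_approx dO Oy Ow ltr01 e20.
have := kob_le (chain_cat zy yw); lra.
Qed.

Lemma kob_pseudometric Om : domain Om -> pseudometric Om (kob Om).
Proof.
move=> dO; split=> [z _|z w _ _|z y w Oz Oy Ow].
- exact: kobxx.
- exact: kobC.
- exact: kob_triangle.
Qed.

Lemma kob_subset Om V z w : domain V -> V `<=` Om -> V z -> V w ->
  kob Om z w <= kob V z w.
Proof.
move=> dV VO Vz Vw; apply/ler_addgt0Pr => e e0.
have [s zw hs] := kob_approx dV Vz Vw ltr01 e0.
by have := kob_le (chain_subset VO zw); lra.
Qed.

Definition links Om eta (p : nat -> Cd R d) (l : nat -> R) n : Prop :=
  forall i, (i < n)%N ->
    link Om (p i) (p i.+1) (l i.+1 - l i) /\ l i.+1 - l i <= eta.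

Lemma links_chain Om eta p l n i j : links Om eta p l n ->
  (i <= j)%N -> (j <= n)%N -> chain Om eta (p i) (p j) (l j - l i).
Proof.
move=> H ij jn; exists (j - i)%N, (fun k => p (i + k)%N), (fun k => l (i + k)%N).
split; rewrite ?addn0 ?subnKC // => k kj; rewrite addnS; apply: H; lia.
Qed.

Lemma links_in Om eta p l n i : links Om eta p l n -> Om (p 0%N) -> (i <= n)%N -> Om (p i).
Proof. by move=> H O0 i_n; apply: chain_in (links_chain H (leq0n i) i_n) O0. Qed.

(** The two outer pieces are at least as long as the distances they span, so the excess of the
    middle piece is at most that of the whole path. *)
Lemma links_almost_geodesic Om eta eps p l n i j : domain Om -> links Om eta p l n ->
  Om (p 0%N) -> l n - l 0%N <= kob Om (p 0%N) (p n) + eps ->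
  (i <= j)%N -> (j <= n)%N -> l j - l i <= kob Om (p i) (p j) + eps.
Proof.
move=> dO H O0 short ij jn.
have h1 := kob_le (links_chain H (leq0n i) (leq_trans ij jn)).
have h2 := kob_le (links_chain H jn (leqnn n)).
have In := fun k => links_in (i := k) H O0.
have h3 := kob_triangle dO O0 (In i (leq_trans ij jn)) (In n (leqnn n)).
have h4 := kob_triangle dO (In i (leq_trans ij jn)) (In j jn) (In n (leqnn n)).
lra.
Qed.

Lemma kob_almost_length Om eta eps : domain Om -> 0 < eta -> 0 < eps ->
  almost_length_space Om (kob Om) eps eta.
Proof.
move=> dO eta0 eps0 z w Oz Ow.
have [s [n [p [l [p0 pn ls H]]]] hs] := kob_approx dO Oz Ow eta0 eps0.
have O0 : Om (p 0%N) by rewrite p0.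
exists p, l, n; split=> //; split.
- by move=> i i_n; exact: (links_in H O0 i_n).
- move=> i j ij jn; have c := links_chain H ij jn; split.
  + by rewrite -subr_ge0 (chain_ge0 c).
  + by rewrite mul1r (kob_le c).
  + by apply: (links_almost_geodesic dO H) => //; rewrite ls p0 pn ltW.
- by move=> i i_n; have [] := H i i_n.
Qed.

Lemma chain_cross Om eta z w s x rho : chain Om eta z w s ->
  nrm (z - x) <= rho -> rho <= nrm (w - x) ->
  exists m s1, [/\ chain Om eta z m s1, chain Om eta m w (s - s1) & nrm (m - x) = rho].
Proof.
move=> [n [p [l [<- <- <- H]]]] zr.
elim: n H => [|n IH] H wr.
  exists (p 0%N), 0; rewrite !subrr; split; [exact: chain0|exact: chain0|lra].
have [lk le] := H n (ltnSn n).
have [big|small] := leP rho (nrm (p n - x)).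
  have [m [s1 [c1 c2 mr]]] := IH (fun i i_n => H i (ltnW i_n)) big.
  exists m, s1; split=> //.
  have -> : l n.+1 - l 0%N - s1 = (l n - l 0%N - s1) + (l n.+1 - l n) by lra.
  by apply: chain_cat c2 _; exact: chain_link.
have [m [s1 [/andP[s10 s11] l1 l2 mr]]] := link_cross lk (ltW small) wr.
exists m, (l n - l 0%N + s1); split=> //.
  by apply: chain_cat (links_chain H (leq0n n) (leqnSn n)) _; apply: chain_link => //; lra.
have -> : l n.+1 - l 0%N - (l n - l 0%N + s1) = l n.+1 - l n - s1 by lra.
by apply: chain_link => //; lra.
Qed.

(** Cut an almost minimizing chain where it meets the sphere. *)
Lemma kob_cross Om z w x rho eps : domain Om -> Om z -> Om w -> 0 < eps ->
  nrm (z - x) <= rho -> rho <= nrm (w - x) ->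
  exists m, [/\ Om m, nrm (m - x) = rho & kob Om z m + kob Om m w <= kob Om z w + eps].
Proof.
move=> dO Oz Ow eps0 zr wr.
have [s zw hs] := kob_approx dO Oz Ow ltr01 eps0.
have [m [s1 [c1 c2 mr]]] := chain_cross zw zr wr.
exists m; split=> //; first exact: chain_in c1 Oz.
have := kob_le c1; have := kob_le c2; lra.
Qed.

Lemma kob_continuous Om a eps : open Om -> Om a -> 0 < eps ->
  exists2 r, 0 < r & forall v, nrm (v - a) < r -> Om v /\ kob Om a v < eps.
Proof.
move=> oO Oa eps0; have [r r0 rO] := open_eball oO Oa.
exists (Num.min (r / 2) (r * eps / 2)); first by rewrite lt_min !divr_gt0 ?mulr_gt0.
move=> v; rewrite lt_min => /andP[v1 v2]; split.
  by apply: rO; rewrite /eball /=; lra.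
apply: le_lt_trans (kob_ball r0 rO v1) _.
by rewrite mulrA ltr_pdivrMr //; lra.
Qed.

End KobayashiDomain.

(** * Compactness of spheres *)

Lemma ler_norm_coord (K : numFieldType) n (v : 'rV[K]_n) i : `|v ord0 i| <= `|v|.
Proof.
rewrite [leRHS]mx_normE -[leLHS]nngE num_le.
exact: (le_bigmax _ (fun ij : 'I_1 * 'I_n => `|v ij.1 ij.2|%:nng) (ord0, i)).
Qed.

Section Compactness.
Context {R : realType} {d : nat}.

Lemma compact_complex_square (M : R) :
  compact [set z : Cplx R | `|complex.Re z| <= M /\ `|complex.Im z| <= M].
Proof.
pose h (st : R * R) : Cplx R := Complex st.1 st.2.
have -> : [set z : Cplx R | `|complex.Re z| <= M /\ `|complex.Im z| <= M] =
    h @` (`[- M, M] `*` `[- M, M]).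
  apply/seteqP; split=> [[s t] /= [sM tM]|z [[s t] /= [+ +] <-]].
    by exists (s, t) => //=; rewrite !in_itv /= -!ler_norml.
  by rewrite !in_itv /= -!ler_norml.
apply: continuous_compact; last by apply: compact_setX; apply: segment_compact.
apply: continuous_subspaceT => -[s t] A /nbhs_ballP[e /= e0 eA].
have er : e \is Num.real by rewrite realE ltW.
have e0' : 0 < complex.Re e by rewrite -ltcR RRe_real.
apply/nbhs_ballP; exists (complex.Re e / 2); first by rewrite /= divr_gt0.
move=> [s' t'] [/= s1 t1]; apply: eA.
rewrite -ball_normE /= normC_cabs -(RRe_real er) ltcR.
have -> : h (s, t) - h (s', t') = (s - s')%:C%C + (0 +i* 1)%C * (t - t')%:C%C.
  by apply/eqP; rewrite eq_complex /=; apply/andP; split; apply/eqP; rewrite /=; ring.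
have tri (u v : R[i]) : cabs (u + v) <= cabs u + cabs v.
  by rewrite -lecR rmorphD /= -!normC_cabs ler_normD.
apply: le_lt_trans (tri _ _) _.
have i1 : cabs (0 +i* 1)%C = 1 :> R by rewrite /cabs normc_def /= expr0n expr1n add0r sqrtr1.
rewrite cabsM i1 !cabs_real mul1r.
by move: s1 t1; rewrite /ball /=; lra.
Qed.

Lemma closed_sphere (x : Cd R d) (rho : R) : closed [set v : Cd R d | nrm (v - x) = rho].
Proof.
move=> v /closure_eball cv /=; apply/eqP; rewrite eq_le; apply/andP.
split; apply/ler_addgt0Pr => e e0; have [u /= ur uv] := cv e e0.
  have := nrm_triangle u v x; rewrite (nrm_distC v u); move: uv; rewrite /eball /=; lra.
have := nrm_triangle v u x; move: uv; rewrite /eball /=; lra.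
Qed.

Lemma compact_sphere (x : Cd R d) (rho : R) : compact [set v : Cd R d | nrm (v - x) = rho].
Proof.
pose M := nrm x + rho.
apply: (subclosed_compact (closed_sphere (x := x) (rho := rho))
  (@rV_compact (Cplx R) d
    (fun=> [set z : Cplx R | `|complex.Re z| <= M /\ `|complex.Im z| <= M])
    (fun=> compact_complex_square (M := M)))).
move=> v /= vr i.
have vM : nrm v <= M.
  by have := nrmD (v - x) x; rewrite subrK vr /M addrC.
have ci : cabs (v ord0 i) <= M.
  apply: le_trans vM; rewrite -lecR -normC_cabs -norm_nrm.
  exact: (@ler_norm_coord R[i]).
have re : `|complex.Re (v ord0 i)| <= cabs (v ord0 i).
  rewrite /cabs normc_def /= -sqrtr_sqr ler_sqrt ?lerDl ?sqr_ge0 //.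
  by rewrite addr_ge0 ?sqr_ge0.
have im : `|complex.Im (v ord0 i)| <= cabs (v ord0 i).
  rewrite /cabs normc_def /= -sqrtr_sqr ler_sqrt ?lerDr ?sqr_ge0 //.
  by rewrite addr_ge0 ?sqr_ge0.
by split; apply: le_trans ci.
Qed.

End Compactness.

(** * Lower bounds for the Kobayashi distance, and localization *)

Section Separation.
Context {R : realType} {d : nat}.
Implicit Types (Om U V : set (Cd R d)) (x y z w a b m : Cd R d) (c s t eta eps r rho : R).

(** Constants may be shrunk, so finitely many local ones have a common positive value.
    Near-coverings express this with [c] tending to [0] from the right. *)
Lemma compact_uniform_constant (K : set (Cd R d)) (P : R -> Cd R d -> Prop) :
  compact K -> (forall c c' v, P c v -> c' <= c -> P c' v) ->
  (forall v, K v -> exists2 c, 0 < c & forall v', nrm (v' - v) < c -> P c v') ->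
  exists2 c, 0 < c & forall v, K v -> P c v.
Proof.
move=> /compact_near_coveringP cK mono loc.
have H : \forall c \near (0 : R)^'+, K `<=` P c.
  apply: cK => v Kv; have [c c0 cP] := loc v Kv.
  exists (eball v c, [set c' | c' < c]).
    by split; [apply/nbhs_eball; exists c|exact: nbhs_right_lt].
  by move=> [v' c'] /= [h1 h2]; apply: (mono c); [exact: cP|exact: ltW].
have [c [cP c0]] : exists c, (K `<=` P c) /\ 0 < c.
  near (0 : R)^'+ => c; exists c; split.
    by near: c.
  by near: c; exact: nbhs_right_gt.
by exists c.
Unshelve. all: by end_near. Qed.

(** By hyperbolicity and compactness, [kob Om a] is bounded below on a small sphere around [a], and
    every path to a far point crosses that sphere. *)
Lemma kob_separated_interior Om a rho : domain Om -> kob_hyperbolic Om -> Om a -> 0 < rho ->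
  exists2 c, 0 < c & forall z w, Om z -> Om w -> nrm (z - a) < c -> rho <= nrm (w - a) ->
    c <= kob Om z w.
Proof.
move=> dO hyp Oa rho0; have [oO _ _] := dO.
have [r r0 rO] := open_eball oO Oa.
pose rho' := Num.min rho (r / 2).
have rho'0 : 0 < rho' by rewrite lt_min rho0 divr_gt0.
have rho'r : rho' < r.
  have : rho' <= r / 2 by rewrite ge_min lexx orbT.
  lra.
have SO v : nrm (v - a) = rho' -> Om v by move=> vr; apply: rO; rewrite /eball /= vr.
have [|v vr|c c0 cP] := compact_uniform_constant (compact_sphere (x := a) (rho := rho'))
    (P := fun c v => c <= kob Om a v).
- by move=> c c' v h1 h2; apply: le_trans h1.
- have Ov := SO v vr.
  have k0 : 0 < kob Om a v.
    rewrite lt_neqAle kob_ge0 andbT; apply/eqP => /esym/(hyp _ _ Oa Ov) av.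
    by move: vr; rewrite av /= subrr nrm0 => e; rewrite -e ltxx in rho'0.
  have k20 : 0 < kob Om a v / 2 by rewrite divr_gt0.
  have [r1 r10 r1P] := kob_continuous oO Ov k20.
  exists (Num.min r1 (kob Om a v / 2)); first by rewrite lt_min r10.
  move=> v'; rewrite lt_min => /andP[v'1 _].
  have [Ov' kv'] := r1P v' v'1.
  have := kob_triangle dO Oa Ov' Ov; rewrite (kobC _ v' v).
  have : Num.min r1 (kob Om a v / 2) <= kob Om a v / 2 by rewrite ge_min lexx orbT.
  lra.
have far w : Om w -> rho <= nrm (w - a) -> c <= kob Om a w.
  move=> Ow wr; apply/ler_addgt0Pr => e e0.
  have [||m [Om_ mr km]] := @kob_cross _ _ Om a w a rho' e dO Oa Ow e0.
  - by rewrite subrr nrm0 ltW.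
  - by apply: le_trans wr; rewrite ge_min lexx.
  have := cP m mr; have := kob_ge0 Om m w; lra.
have c20 : 0 < c / 2 by lra.
have [r1 r10 r1P] := kob_continuous oO Oa c20.
exists (Num.min r1 (c / 2)); first by rewrite lt_min r10.
move=> z w Oz Ow; rewrite lt_min => /andP[zr1 _] wr.
have [_ kz] := r1P z zr1; have := far w Ow wr.
have := kob_triangle dO Oa Oz Ow.
have : Num.min r1 (c / 2) <= c / 2 by rewrite ge_min lexx orbT.
lra.
Qed.

Lemma kob_separated_bdry Om a b : hyp_embedded Om -> bdry Om a -> bdry Om b -> a <> b ->
  exists2 c, 0 < c & forall z w, Om z -> Om w -> nrm (z - a) < c -> nrm (w - b) < c ->
    c <= kob Om z w.
Proof.
move=> he ba bb ab; have /ereal_sup_gt[y [r /= r0 <-]] := he a b ba bb ab.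
set I := ereal_inf _ => I0.
have [c c0 cI] : exists2 c : R, 0 < c & (c%:E <= I)%E.
  case: I I0 => [i i0|_|//]; first by exists i.
  (* The infimum is infinite when no pair of points of [Om] is that close to [a] and [b]; any
     constant then works. *)
  by exists 1 => //; rewrite leey.
exists (Num.min r c); first by rewrite lt_min r0.
move=> z w Oz Ow; rewrite !lt_min => /andP[zr _] /andP[wr _].
apply: (@le_trans _ _ c); first by rewrite ge_min lexx orbT.
rewrite -lee_fin; apply: le_trans cI _; apply: ereal_inf_lbound.
by exists (z, w).
Qed.

Lemma kob_separated Om a b : domain Om -> kob_hyperbolic Om -> hyp_embedded Om -> a <> b ->
  exists2 c, 0 < c & forall z w, Om z -> Om w -> nrm (z - a) < c -> nrm (w - b) < c ->
    c <= kob Om z w.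
Proof.
move=> dO hyp he ab.
have rho0 : 0 < nrm (a - b) / 2.
  rewrite divr_gt0 // lt_neqAle nrm_ge0 andbT eq_sym nrm_eq0 subr_eq0.
  exact/eqP.
have out y : ~ closure Om y -> exists2 c, 0 < c & forall z, Om z -> c <= nrm (z - y).
  move=> cy; apply: contrapT => H; apply: cy; apply/closure_eball => c c0.
  apply: contrapT => H'; apply: H; exists c => // z Oz; rewrite leNgt; apply/negP => zc.
  by apply: H'; exists z.
have [ca|/out[c c0 cP]] := pselect (closure Om a); last first.
  by exists c => // z w Oz Ow; rewrite ltNge cP.
have [cb|/out[c c0 cP]] := pselect (closure Om b); last first.
  by exists c => // z w Oz Ow _; rewrite ltNge cP.
have [Oa|nOa] := pselect (Om a).
  have [c c0 cP] := kob_separated_interior dO hyp Oa rho0.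
  exists (Num.min c (nrm (a - b) / 2)); first by rewrite lt_min c0.
  move=> z w Oz Ow; rewrite !lt_min => /andP[zc _] /andP[_ wb].
  apply: (@le_trans _ _ c); first by rewrite ge_min lexx.
  by apply: cP => //; have := nrm_triangle w a b; rewrite (nrm_distC a w); lra.
have [Ob|nOb] := pselect (Om b).
  have [c c0 cP] := kob_separated_interior dO hyp Ob rho0.
  exists (Num.min c (nrm (a - b) / 2)); first by rewrite lt_min c0.
  move=> z w Oz Ow; rewrite !lt_min => /andP[_ za] /andP[wc _].
  apply: (@le_trans _ _ c); first by rewrite ge_min lexx.
  rewrite kobC; apply: cP => //.
  by have := nrm_triangle z a b; rewrite (nrm_distC a z); lra.
exact: kob_separated_bdry.
Qed.

(** A path between the two regions crosses both spheres, and two nested compactness arguments make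
    the pointwise separation uniform on pairs of points of the spheres. *)
Lemma kob_separated_balls Om x r1 r2 : domain Om -> kob_hyperbolic Om -> hyp_embedded Om ->
  r1 < r2 ->
  exists2 c, 0 < c & forall z w, Om z -> Om w -> nrm (z - x) <= r1 -> r2 <= nrm (w - x) ->
    c <= kob Om z w.
Proof.
move=> dO hyp he r12.
have [||c c0 cP] := compact_uniform_constant (compact_sphere (x := x) (rho := r1))
    (P := fun c v => forall v', nrm (v' - x) = r2 -> Om v -> Om v' -> c <= kob Om v v').
- by move=> c c' v h1 h2 v' v'r Ov Ov'; apply: le_trans (h1 v' v'r Ov Ov').
- move=> v vr.
  have [||c c0 cP] := compact_uniform_constant (compact_sphere (x := x) (rho := r2))
    (P := fun c v' => forall u, nrm (u - v) < c -> Om u -> Om v' -> c <= kob Om u v').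
  + move=> c c' v' h1 h2 u uv Ou Ov'; apply: le_trans (h1 u _ Ou Ov') => //.
    exact: lt_le_trans h2.
  + move=> v' v'r; have [|c c0 cP] := @kob_separated Om v v' dO hyp he.
      by move=> vv'; move: r12; rewrite -vr -v'r vv' ltxx.
    by exists c => // u' u'v' u uv Ou Ou'; apply: cP.
  by exists c => // u uv v' v'r Ou Ov'; apply: cP.
exists c => // z w Oz Ow zr wr; apply/ler_addgt0Pr => e e0.
have e20 : 0 < e / 2 by lra.
have [|m1 [Om1 m1r k1]] := @kob_cross _ _ Om z w x r1 _ dO Oz Ow e20 zr.
  by apply: le_trans wr; exact: ltW.
have [|m2 [Om2 m2r k2]] := @kob_cross _ _ Om m1 w x r2 _ dO Om1 Ow e20 _ wr.
  by rewrite m1r ltW.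
have := cP m1 m1r m2 m2r Om1 Om2.
have := kob_ge0 Om z m1; have := kob_ge0 Om m2 w; lra.
Qed.

(* Royden's localization: a disc through z reaches the complement of U only at
   hyperbolic radius c0, so its restriction to the disc of radius tanh c0 lies in U. *)
Lemma kob_localize c0 : 0 < c0 -> exists A eta0, [/\ 0 < A, 0 < eta0 &
  forall Om U z q s, (forall w, Om w -> kob Om z w < c0 -> U w) ->
    link Om z q s -> s <= eta0 -> (Om `&` U) q /\ kob (Om `&` U) z q <= A * s].
Proof.
move=> c00; have [r [r0' r1 rc]] := artanh_surj (ltW c00).
have r0 : 0 < r.
  rewrite lt_neqAle r0' andbT; apply/eqP => e.
  by move: c00; rewrite -rc -e artanh0 ltxx.
(* From [t <= 2 * artanh t <= r / 2], the rescaled parameter [t / r] is at most one half, where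
   [artanh] is at most twice its argument; this gives the factor [4 / r]. *)
exists (4 / r), (r / 4); split; rewrite ?divr_gt0 // => Om U z q s near_U.
move=> [g [t [hg /andP[t0 t1] gz gq ->]]] sr.
have ts := artanh_ge t0 t1.
have tr : t <= r / 2 by lra.
pose h (u : Cplx R) : Cplx R := 0 + u *: (r%:C%C : Cplx R).
have hu (u : R[i]) : h u = u * r%:C%C by rewrite /h add0r.
have hol : holo_disc (Om `&` U) (g \o h).
  move=> u u1.
  have hc : cabs (h u) < r.
    by rewrite hu cabsM cabs_real ger0_norm // -[ltRHS]mul1r ltr_pM2r.
  have hc1 : cabs (h u) < 1 by apply: lt_trans r1.
  have [dg Og] := hg _ hc1.
  split.
    exact (@derivable_disc_comp R[i] 'rV[R[i]^o]_d g h u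
      (@derivable_line R[i] R[i]^o 0 r%:C%C u) dg).
  split=> //; apply: near_U => //=.
  apply: le_lt_trans (_ : artanh (cabs (h u)) < _); last first.
    by rewrite -rc; apply: artanh_mono => //; exact: cabs_ge0.
  rewrite -gz; have := kob_le_link (disc_link hg (a := 0) (b := h u) _ hc1).
  rewrite /poincare /artanh conjC0 mul0r subr0 divr1 sub0r cabsN cabs0.
  by apply.
have tr01 : 0 <= t / r < 1 by rewrite divr_ge0 ?(ltW r0) //= ltr_pdivrMr //; lra.
have lk : link (Om `&` U) z q (artanh (t / r)).
  exists (g \o h), (t / r); split=> //=.
    by rewrite hu mul0r.
  by rewrite hu -rmorphM /= divfK // gt_eqF.
split; first exact: link_inr lk.
apply: le_trans (kob_le_link lk) _.
apply: le_trans (artanh_le _ _) _; first by case/andP: tr01.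
  by rewrite ler_pdivrMr //; lra.
by rewrite [leRHS]mulrAC mulrA ler_pM2r ?invr_gt0 //; lra.
Qed.

End Separation.

(** * Euclidean and Gromov boundary of a model domain *)
Section GromovBoundary.
Context {R : realType} {d : nat} (V : set (Cd R d)) (o : Cd R d) (delta : R).
Hypothesis dV : domain V.
Hypothesis hV : hyperbolic V (kob V) delta.
Hypothesis delta0 : 0 <= delta.
Hypothesis Vo : V o.
Implicit Types (x y z w : Cd R d) (r M : R) (s t : nat -> Cd R d) (p q : GC R d).

(* A point of V is represented by its constant sequence. *)
Definition gc_rep p : set (nat -> Cd R d) :=
  match p with inl z => [set fun=> z] | inr Xi => Xi end.

(** A lower bound on the Gromov product in the compactification, phrased by representatives; up to
    making an inequality strict it agrees with [gprod_bd] and avoids extended reals. *)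
Definition gc_close p q M : Prop :=
  forall s t, gc_rep p s -> gc_rep q t ->
    exists N, forall i j, (N <= i)%N -> (N <= j)%N -> M <= gprod V o (s i) (t j).

Lemma gprod_bd_close p Xi r : (r%:E < gprod_bd V o p Xi)%E -> gc_close p (inr Xi) r.
Proof.
case: p => [z|T] /= rp s t ps Xt.
  have : (r%:E < eliminf (fun j => gprod V o z (t j)))%E.
    by apply: lt_le_trans rp _; apply: ereal_inf_lbound; exists t.
  move=> /ereal_sup_gt[_ [N _ <-]] rN; exists N => i j _ Nj.
  rewrite ps -lee_fin ltW //; apply: lt_le_trans rN _.
  by apply: ereal_inf_lbound; exists j.
have : (r%:E < eliminf2 (fun i j => gprod V o (s i) (t j)))%E.
  by apply: lt_le_trans rp _; apply: ereal_inf_lbound; exists (s, t).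
move=> /ereal_sup_gt[_ [N _ <-]] rN; exists N => i j Ni Nj.
rewrite -lee_fin ltW //; apply: lt_le_trans rN _.
by apply: ereal_inf_lbound; exists (i, j).
Qed.

Lemma close_gprod_bd p Xi r r' : r < r' -> gc_close p (inr Xi) r' ->
  (r%:E < gprod_bd V o p Xi)%E.
Proof.
move=> rr' H; apply: (@lt_le_trans _ _ r'%:E); first by rewrite lte_fin.
case: p H => [z|T] H /=; apply: le_ereal_inf_tmp => y.
  move=> [t Xt <-]; have [N NP] := H _ t erefl Xt.
  apply: le_ereal_sup_tmp; eexists; first by exists N.
  by apply: le_ereal_inf_tmp => y' [j /= Nj <-]; rewrite lee_fin; exact: (NP N).
move=> [[s t] [/= Ts Xt] <-]; have [N NP] := H s t Ts Xt.
apply: le_ereal_sup_tmp; eexists; first by exists N.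
by apply: le_ereal_inf_tmp => y' [[i j] /= [Ni Nj] <-]; rewrite lee_fin; exact: NP.
Qed.

Lemma gc_rep_in p s i : gc_carrier V o p -> gc_rep p s -> V (s i).
Proof.
case: p => [z|Xi] /=; first by move=> Vz ->.
by move=> [s0 [_ ->]] [[]].
Qed.

Lemma gromov_class_refl s : gromov_seq V o s -> gromov_equiv V o s s.
Proof. by move=> [_ H] M; have [N NP] := H M; exists N => n Nn; apply: NP. Qed.

Lemma gc_rep_neq0 p : gc_carrier V o p -> exists s, gc_rep p s.
Proof.
case: p => [z|Xi] /=; first by exists (fun=> z).
by move=> [s0 [gs ->]]; exists s0; split=> //; exact: gromov_class_refl.
Qed.

Lemma gc_close_trans p q q' M : gc_carrier V o p -> gc_carrier V o q -> gc_carrier V o q' ->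
  gc_close p q M -> gc_close q q' M -> gc_close p q' (M - delta).
Proof.
move=> cp cq cq' pq qq' s t ps qt; have [u qu] := gc_rep_neq0 cq.
have [N1 N1P] := pq s u ps qu; have [N2 N2P] := qq' u t qu qt.
exists (maxn N1 N2) => i j; rewrite !geq_max => /andP[i1 i2] /andP[j1 j2].
apply: (hyperbolicP (y := u (maxn N1 N2)) hV Vo).
- exact: gc_rep_in ps.
- exact: gc_rep_in qu.
- exact: gc_rep_in qt.
- by apply: N1P => //; exact: leq_maxl.
- by apply: N2P => //; exact: leq_maxr.
Qed.

(** The homeomorphism transports open sets only, so a basic set is replaced by the points having a
    basic neighbourhood inside it. *)
Definition gc_interior (B : set (GC R d)) : set (GC R d) :=
  [set p | gc_carrier V o p /\ exists r, 0 < r /\ gc_basic V o p r `<=` B].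

Lemma gc_interior_open B : gc_open V o (gc_interior B).
Proof.
have d0 := delta0.
split=> [p []//|[z|Xi] [cp [r [r0 rB]]]].
  exists r; split=> // _ [w [-> Vw zw]]; split=> //=.
  exists (r - kob V z w); split; first by rewrite subr_gt0.
  move=> _ [v [-> Vv wv]]; apply: rB; exists v; split=> //.
  by have := kob_triangle dV cp Vw Vv; lra.
(* The margin absorbs a move by [1] inside [V], or one use of hyperbolicity at another boundary
   point, and keeps the inequality strict. *)
exists (r + delta + 2); split; first by lra.
move=> q [cq /gprod_bd_close qXi]; split=> //; case: q cq qXi => [w|Xi'] cq qXi.
  exists 1; split=> // _ [v [-> Vv wv]]; apply: rB; split=> //.
  apply: (@close_gprod_bd _ _ _ (r + 1)); first by lra.
  move=> s t -> Xt; have [N NP] := qXi _ t erefl Xt; exists N => i j Ni Nj.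
  have := NP i j Ni Nj; rewrite /gprod.
  have Vt : V (t j) by apply: (gc_rep_in j cp).
  have := kob_triangle dV cq Vv Vo; have := kob_triangle dV Vv cq Vt.
  rewrite (kobC V v w); lra.
exists (r + delta + 2); split; first by lra.
move=> q [cq' /gprod_bd_close qXi']; apply: rB; split=> //.
apply: (@close_gprod_bd _ _ _ (r + delta + 2 - delta)); first by lra.
exact: (gc_close_trans cq' cq cp qXi' qXi).
Qed.

(** The sequence represents the Gromov boundary point that corresponds to [x]. The two estimates
    express continuity of the inverse homeomorphism at [x] and of the homeomorphism at that boundary
    point. *)
Lemma model_gromov_seq x : gc_ec_homeo V o -> closure V x -> ~ V x ->
  exists s, [/\ forall n, V (s n),
    (forall M, exists2 r, 0 < r & forall z, V z -> nrm (z - x) < r ->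
       exists N, forall n, (N <= n)%N -> M <= gprod V o z (s n))
    & (forall r, 0 < r -> exists M, forall z, V z ->
       (exists N, forall n, (N <= n)%N -> M <= gprod V o z (s n)) -> nrm (z - x) < r)].
Proof.
have d0 := delta0.
move=> [phi [phiV [phic phi_inj phi_surj phi_cont phi_open]]] cx nVx.
have [p [cp px]] := phi_surj (inl x) cx.
case: p cp px => [z Vz|Xi cXi] px; first by move: px; rewrite phiV // => -[zx]; case: nVx; rewrite -zx.
have [s [gs eXi]] := cXi.
have Xs : Xi s by rewrite eXi; split=> //; exact: gromov_class_refl.
exists s; split; first by case: gs.
- move=> M; pose M' := Num.max M 1.
  have M'0 : 0 < M' by rewrite lt_max ltr01 orbT.
  pose B := gc_basic V o (inr Xi) M'.
  have [_ /(_ (inl x))[|r [n [r0 rP]]]] := phi_open _ (gc_interior_open B).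
    by exists (inr Xi) => //; split=> //; exists M'; split.
  exists r => // z Vz zr.
  have [|q [cq [r' [r'0 r'B]]] qz] := rP (inl z).
    by exists z; split; [reflexivity|exact: subset_closure|exact: zr].
  have qE : q = inl z by apply: phi_inj => //; rewrite qz phiV.
  rewrite {}qE in r'B.
  have /r'B[_ /gprod_bd_close/(_ (fun=> z) s erefl Xs)[N NP]] : gc_basic V o (inl z) r' (inl z).
    by exists z; rewrite kobxx.
  exists N => m Nm; apply: (@le_trans _ _ M'); first by rewrite le_max lexx.
  exact: (NP m).
- move=> r r0.
  pose E : set (EC R d) := fun e => match e with
    | inl y => closure V y /\ nrm (y - x) < r | inr _ => False end.
  have oE : ec_open V E.
    split; first by case=> [y []|].
    case=> [y [cy yr]|//]; exists (r - nrm (y - x)), 0%N; split; first by rewrite subr_gt0.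
    move=> _ [w [-> cw wy]]; split=> //.
    by have := nrm_triangle y w x; lra.
  have [_ /(_ (inr Xi))[|M [M0 MP]]] := phi_cont E oE.
    by split=> //; rewrite /preimage /= px; split=> //; rewrite subrr nrm0.
  (* Passing from [s] to another representative costs [delta], and [1] makes the inequality
     strict. *)
  exists (M + delta + 1) => z Vz [N NP].
  have [|_] := MP (inl z).
    split=> //; apply: (@close_gprod_bd _ _ _ (M + delta + 1 - delta)); first by lra.
    move=> u t -> Xt; have := Xt; rewrite {1}eXi => -[[Vt _] st].
    have [N2 N2P] := st (M + delta + 1).
    have [_ /(_ (M + delta + 1))[N3 N3P]] := gs.
    exists (maxn N N2) => i j _; rewrite geq_max => /andP[j1 j2].
    apply: (hyperbolicP (y := s j) hV Vo) => //.
    + by case: gs.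
    + exact: NP.
    + exact: N2P.
  by rewrite /preimage /= phiV // => -[].
Qed.

(** Eliminates the sequence by comparing [z] and [w] through one far term of it, at the cost of
    [delta]. *)
Lemma model_gprod_near x : gc_ec_homeo V o -> closure V x -> ~ V x ->
  (forall M, exists2 r, 0 < r & forall z w, V z -> V w ->
     nrm (z - x) < r -> nrm (w - x) < r -> M <= gprod V o z w) /\
  (forall r, 0 < r -> exists M, exists2 r', 0 < r' & forall z w, V z -> V w ->
     nrm (z - x) < r' -> M <= gprod V o z w -> nrm (w - x) < r).
Proof.
have d0 := delta0.
move=> hom cx nVx; have [s [Vs near_s s_near]] := model_gromov_seq hom cx nVx.
have gC z w : V z -> V w -> gprod V o z w = gprod V o w z.
  by move=> Vz Vw; apply: (gromov_productC o (kob_pseudometric dV)).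
split=> [M|r r0].
  have [r r0 rP] := near_s (M + delta); exists r => // z w Vz Vw zr wr.
  have [N1 H1] := rP z Vz zr; have [N2 H2] := rP w Vw wr.
  have := H1 _ (leq_maxl N1 N2); have := H2 _ (leq_maxr N1 N2).
  rewrite (gC w) // => h2 h1.
  rewrite -[M](addrK delta); exact: (hyperbolicP hV Vo Vz (Vs _) Vw h1 h2).
have [M MP] := s_near r r0; have [r' r'0 r'P] := near_s (M + delta).
exists (M + delta), r' => // z w Vz Vw zr' zw; apply: MP => //.
have [N NP] := r'P z Vz zr'; exists N => n Nn.
rewrite gC // in zw.
rewrite -[M](addrK delta); exact: (hyperbolicP hV Vo Vw Vz (Vs n) zw (NP n Nn)).
Qed.

End GromovBoundary.

(** * Localization at a boundary point *)
Section Localization.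
Context {R : realType} {d : nat}.
Implicit Types (Om U V : set (Cd R d)) (x y z w o : Cd R d) (r M C : R).

(* A near-minimal path from w to t in Om, stopped when it leaves the ball of
   radius a, is a quasi-geodesic of Om `&` U. *)
Lemma localized_path Om U x (a b A c1 eta : R) w t :
  domain Om -> domain (Om `&` U) -> a <= b -> 0 < eta -> 0 <= A ->
  (forall z q s, Om z -> nrm (z - x) <= b -> link Om z q s -> s <= eta ->
     (Om `&` U) q /\ kob (Om `&` U) z q <= A * s) ->
  (forall z, Om z -> nrm (z - x) <= b -> U z) ->
  eta < c1 ->
  (forall z w, Om z -> Om w -> nrm (z - x) <= a -> b <= nrm (w - x) -> c1 <= kob Om z w) ->
  Om w -> Om t -> nrm (w - x) <= a ->
  exists p l n, [/\ p 0%N = w, p n = t \/ a <= nrm (p n - x), links Om eta p l n,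
    quasigeodesic (Om `&` U) (kob (Om `&` U)) A 1 eta p l n
    & l n - l 0%N + kob Om (p n) t <= kob Om w t + 1].
Proof.
move=> dO dV ab eta0 A0 loc bU etac1 sep Ow Ot wa.
have [s [N [p [l [p0 pN ls H]]]] hs] := kob_approx dO Ow Ot eta0 ltr01.
have O0 : Om (p 0%N) by rewrite p0.
have Op i : (i <= N)%N -> Om (p i) := fun iN => links_in H O0 iN.
(* Stop at the first point outside the ball of radius [a], or at [t] if the path never leaves it. *)
have [n [nN pn inner]] : exists n, [/\ (n <= N)%N, p n = t \/ a <= nrm (p n - x)
    & forall i, (i < n)%N -> nrm (p i - x) <= a].
  have [ex|nex] := pselect (exists i, (i <= N)%N && (a < nrm (p i - x))).
    case: (ex_minnP ex) => n /andP[nN an] minn; exists n; split=> //.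
      by right; exact: ltW.
    move=> i i_n; rewrite leNgt; apply/negP => ai; have := minn i.
    by rewrite ai (leq_trans (ltnW i_n) nN) leqNgt i_n => /(_ isT).
  exists N; split=> //; first by left.
  by move=> i iN; rewrite leNgt; apply/negP => ai; apply: nex; exists i; rewrite ai ltnW.
have Hn : links Om eta p l n by move=> i i_n; apply: H; exact: leq_trans nN.
have On i : (i <= n)%N -> Om (p i) by move=> i_n; apply: Op; exact: leq_trans nN.
(* The last link may jump out of the ball of radius [a], but not past radius [b], since its length
   is at most [eta < c1]. *)
have inb i : (i <= n)%N -> nrm (p i - x) <= b.
  rewrite leq_eqVlt => /orP[/eqP ->|i_n]; last by apply: le_trans ab; exact: inner.
  case: n nN inner Hn On {pn} => [|n] nN inner Hn On; first by rewrite p0; exact: le_trans ab.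
  rewrite leNgt; apply/negP => bn.
  have [lk le] := Hn n (ltnSn n).
  have := sep _ _ (On n (leqnSn n)) (On n.+1 (leqnn _)) (inner n (ltnSn n)) (ltW bn).
  have := kob_le_link lk; lra.
have Vp i : (i <= n)%N -> (Om `&` U) (p i).
  by move=> i_n; split; [exact: On|apply: bU; [exact: On|exact: inb]].
have up i j : (i <= j)%N -> (j <= n)%N -> kob (Om `&` U) (p i) (p j) <= A * (l j - l i).
  move=> ij; elim: j ij => [|j IH].
    by rewrite leqn0 => /eqP -> _; rewrite kobxx subrr mulr0.
  rewrite leq_eqVlt => /orP[/eqP -> _|]; first by rewrite kobxx subrr mulr0.
  rewrite ltnS => ij jn.
  have [lk le] := Hn j jn.
  have [_ kj] := loc _ _ _ (On j (ltnW jn)) (inb j (ltnW jn)) lk le.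
  have := IH ij (ltnW jn).
  have := kob_triangle dV (Vp i (leq_trans ij (ltnW jn))) (Vp j (ltnW jn)) (Vp j.+1 jn).
  lra.
exists p, l, n; split=> //.
- split=> //.
  + move=> i j ij jn; split.
    * by rewrite -subr_ge0 (chain_ge0 (links_chain Hn ij jn)).
    * exact: up.
    * have jN := leq_trans jn nN.
      have h1 : l j - l i <= kob Om (p i) (p j) + 1.
        by apply: (links_almost_geodesic dO H O0) => //; rewrite ls p0 pN ltW.
      have := kob_subset dV (@subIsetl _ Om U) (Vp i (leq_trans ij jn)) (Vp j jn); lra.
  + by move=> i i_n; have [] := Hn i i_n.
- have := kob_le (links_chain H nN (leqnn N)); rewrite pN; lra.
Qed.

(** In the local model at [x], large Gromov products amount to Euclidean closeness to [x], and
    localized paths carry this over to [Om]. The point [o] is the base point of that model, hence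
    depends on [x]. *)
Lemma boundary_estimates Om x rho0 :
  domain Om -> kob_hyperbolic Om -> hyp_embedded Om ->
  locally_model_gromov_hyperbolic Om -> bdry Om x -> 0 < rho0 ->
  exists o, [/\ Om o,
    forall M, exists2 r, 0 < r & forall w, Om w -> nrm (w - x) < r -> M <= kob Om w o,
    exists C, exists2 r, 0 < r & forall w t, Om w -> Om t -> nrm (w - x) < r ->
      rho0 <= nrm (t - x) -> kob Om w o + kob Om o t <= kob Om w t + C
    & exists C, forall r, 0 < r -> exists z, [/\ Om z, nrm (z - x) < r &
      exists2 r', 0 < r' & forall w, Om w -> nrm (w - x) < r' ->
        kob Om w z + kob Om z o <= kob Om w o + C]].
Proof.
move=> dO hyp he lmg bx rho00; have [clx nOx] := bx.
have [U [oU Ux _ [dV _ [delta [delta0 hV']] [ o [Vo hom]]]]] := lmg x bx.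
set V := Om `&` U in dV hV' Vo hom.
have hV : hyperbolic V (kob V) delta by [].
have pV := kob_pseudometric dV.
have VO : V `<=` Om by exact: subIsetl.
have clV : closure V x.
  apply/closure_eball => r r0; have [r1 r10 r1U] := open_eball oU Ux.
  have m0 : 0 < Num.min r r1 by rewrite lt_min r0.
  have /closure_eball/(_ _ m0)[z Oz] := clx.
  rewrite /eball /= lt_min => /andP[zr zr1].
  by exists z => //; split=> //; exact: r1U.
have nVx : ~ V x by move=> [].
have [P1 P2] := model_gprod_near dV hV delta0 Vo hom clV nVx.
have [r1 r10 r1U] := open_eball oU Ux.
(* Three nested balls: the gap between [b] and [rho] confines short discs to [U], the gap between
   [a] and [b] keeps one link from jumping over it. *)
pose rho := Num.min r1 rho0.
have rho_gt0 : 0 < rho by rewrite lt_min r10.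
have rhorho0 : rho <= rho0 by rewrite ge_min lexx orbT.
have rhoU z : nrm (z - x) < rho -> U z.
  by rewrite lt_min => /andP[zr _]; exact: r1U.
pose b := 2 * rho / 3; pose a := rho / 3.
have a0 : 0 < a by rewrite divr_gt0.
have ab : a < b by rewrite /a /b; lra.
have brho : b < rho by rewrite /b; lra.
have [c0 c00 sep0] := @kob_separated_balls _ _ Om x _ _ dO hyp he brho.
have [c1 c10 sep1] := @kob_separated_balls _ _ Om x _ _ dO hyp he ab.
have [A [eta0 [A0 eta00 loc]]] := @kob_localize R d c0 c00.
pose eta := Num.min eta0 (c1 / 2).
have eta_gt0 : 0 < eta by rewrite lt_min eta00 divr_gt0.
have etac1 : eta < c1.
  have : eta <= c1 / 2 by rewrite ge_min lexx orbT.
  lra.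
have locV z q s : Om z -> nrm (z - x) <= b -> link Om z q s -> s <= eta ->
    V q /\ kob V z q <= A * s.
  move=> Oz zb zq se; apply: loc zq _; last first.
    by apply: le_trans se _; rewrite ge_min lexx.
  move=> w Ow zw; apply: rhoU; rewrite ltNge; apply/negP => /(sep0 z w Oz Ow zb).
  by rewrite leNgt zw.
have bU z : Om z -> nrm (z - x) <= b -> U z.
  by move=> _ zb; apply: rhoU; exact: le_lt_trans brho.
have path w t := @localized_path Om U x a b A c1 eta w t dO dV (ltW ab) eta_gt0 (ltW A0)
  locV bU etac1 sep1.
have geoV := kob_almost_length dV eta_gt0 ltr01.
(* If the product at [z] of [w] with every possible endpoint of the localized path is bounded, the
   path passes near [z], so the triangle inequality through [z] is almost an equality. *)
have key C : exists C', forall w t z, Om w -> Om t -> V z -> nrm (w - x) <= a ->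
    (forall s, V s -> s = t \/ a <= nrm (s - x) -> gprod V z w s <= C) ->
    kob Om w z + kob Om z t <= kob Om w t + C'.
  have [C' C'P] := near_quasigeodesic C pV hV delta0 (ltW A0) ler01 (ltW eta_gt0) geoV.
  exists (2 * C' + 1) => w t z Ow Ot Vz wa gC.
  have [p [l [n [p0 pn lk qp short]]]] := path w t Ow Ot wa.
  have [pVn _ _] := qp.
  have [|j jn zj] := C'P p l n z qp Vz.
    by rewrite p0; apply: gC => //; exact: pVn.
  have Oz := VO _ Vz; have Oj := VO _ (pVn j jn); have On := VO _ (pVn n (leqnn n)).
  have k1 := kob_subset dV VO Vz (pVn j jn).
  have k2 := kob_le (links_chain lk (leq0n j) jn).
  have k3 := kob_le (links_chain lk jn (leqnn n)).
  rewrite p0 in k2.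
  have t1 := kob_triangle dO Ow Oj Oz; rewrite (kobC _ (p j) z) in t1.
  have t2 := kob_triangle dO Oz Oj Ot.
  have t3 := kob_triangle dO Oj On Ot.
  lra.
have [M0 [r0 r00 far]] := P2 a a0.
(* [M0] handles endpoints outside the ball of radius [a]; [0] handles the endpoint [o], whose
   product with anything vanishes. *)
pose M1 := Num.max M0 0.
have M10 : 0 <= M1 by rewrite le_max lexx orbT.
have gM1 w s : V w -> V s -> nrm (w - x) < r0 -> s = o \/ a <= nrm (s - x) ->
    gprod V o w s <= M1.
  move=> Vw Vs wr [->|sa].
    by rewrite /gprod kobxx addr0 subrr mulr0.
  rewrite le_max ltW //= ltNge; apply/negP => /(far w s Vw Vs wr).
  by rewrite ltNge sa.
have inV w : Om w -> nrm (w - x) < a -> V w.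
  by move=> Ow wa; split=> //; apply: rhoU; lra.
exists o; split; first exact: VO.
(* The product of [w] with itself is [kob V w o]. Reaching the end of the localized path saves at
   most [2 * M1] of it, and the factor [A] converts the rest into length in [Om]. *)
- move=> M; have [r r_gt0 rP] := P1 (2 * M1 + A * (M + 1)).
  exists (Num.min r (Num.min r0 a)); first by rewrite !lt_min r_gt0 r00.
  move=> w Ow; rewrite !lt_min => /and3P[wr wr0 wa].
  have Vw := inV w Ow wa.
  have [p [l [n [p0 pn lk qp short]]]] := path w o Ow (VO _ Vo) (ltW wa).
  have [pVn pd _] := qp; have Vn := pVn n (leqnn n).
  have [_ up _] := pd 0%N n (leq0n n) (leqnn n); rewrite p0 in up.
  have := rP w w Vw Vw wr wr; have := gM1 w (p n) Vw Vn wr0 pn.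
  rewrite /gprod kobxx => g1 g2.
  have kn : 0 <= kob V (p n) o := kob_ge0 _ _ _.
  have kn' := kob_ge0 Om (p n) o.
  have h : A * (l n - l 0%N) <= A * (kob Om w o + 1) by apply: ler_wpM2l; [exact: ltW|lra].
  have : A * (M + 1) <= A * (kob Om w o + 1) by lra.
  rewrite ler_pM2l //; lra.
- have [C CP] := key M1; exists C, (Num.min r0 a); first by rewrite lt_min r00.
  move=> w t Ow Ot; rewrite lt_min => /andP[wr0 wa] tr.
  apply: CP => //; first exact: ltW.
  move=> s Vs st; apply: gM1 => //; first exact: inV.
  by right; case: st => // ->; apply: le_trans tr; lra.
- have [C CP] := key (M1 + eta + 1 + delta); exists C => r r_gt0.
  have [M2 [r2 r20 r2P]] := P2 r r_gt0.
  (* The point [z] is chosen at parameter about [T] on an almost geodesic of [V] from [o] to [w0].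
     Its product with [w0] is at least [T - 1 >= M2], which forces [z] to be within [r] of [x]. *)
  pose T := Num.max (M2 + 1) 0.
  have T0 : 0 <= T by rewrite le_max lexx orbT.
  have TM2 : M2 + 1 <= T by rewrite le_max lexx.
  have [rT rT0 rTP] := P1 T.
  have m0 : 0 < Num.min r2 rT by rewrite lt_min r20.
  have /closure_eball/(_ _ m0)[w0 Vw0] := clV.
  rewrite /eball /= lt_min => /andP[w0r2 w0rT].
  have [g [t [m [qg g0 gm]]]] := geoV o w0 Vo Vw0.
  have [gX gt ge] := qg.
  have [lm0 lm1 lm2] := gt 0%N m (leq0n m) (leqnn m).
  rewrite g0 gm mul1r in lm1 lm2.
  have := rTP w0 w0 Vw0 Vw0 w0rT w0rT; rewrite /gprod kobxx (kobC _ w0 o) => w0o.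
  have [|i [im i1 i2]] := geodesic_point qg (ltW eta_gt0) T0; first by lra.
  have [_ z1 z2] := gt 0%N i (leq0n i) im; have [_ z3 _] := gt i m im (leqnn m).
  rewrite g0 mul1r in z1 z2; rewrite gm mul1r in z3.
  have Vz := gX i im; set z := g i in z1 z2 z3 Vz.
  have zw0 : T - 1 <= gprod V o z w0.
    by rewrite /gprod (kobC _ z o) (kobC _ w0 o); lra.
  exists z; split; first exact: VO.
    apply: (r2P w0 z) => //; rewrite /gprod addrAC (kobC _ w0 z).
    by move: zw0; rewrite /gprod; lra.
  exists (Num.min rT (Num.min r0 a)); first by rewrite !lt_min rT0 r00.
  move=> w Ow; rewrite !lt_min => /and3P[wrT wr0 wa].
  have Vw := inV w Ow wa.
  apply: CP => //; [exact: VO|exact: ltW|].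
  (* The product of [z] and [w] at [o] is at least [T - 1 - delta], while [z] is within [T + eta] of
     [o]. Changing the base point from [o] to [z] cancels [T], so the constant does not depend on
     [r]. *)
  move=> s Vs so; have := gM1 w s Vw Vs wr0 so.
  have w0w : T - 1 <= gprod V o w0 w by have := rTP w0 w Vw0 Vw w0rT wrT; lra.
  have := hyperbolicP hV Vo Vz Vw0 Vw zw0 w0w.
  have := kob_triangle dV Vs Vo Vz.
  rewrite /gprod /gromov_product (kobC _ w z) (kobC _ z o); lra.
Qed.

(** Any two balls around [x] share a point of [Om], where the infimum over one is compared with the
    supremum over the other. *)
Lemma busemann_liminf_le_limsup Om o z x : closure Om x ->
  (busemann_liminf Om o z x <= busemann_limsup Om o z x)%E.
Proof.
move=> /closure_eball clx; apply: ge_ereal_sup => u [r /= r0 <-].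
apply: le_ereal_inf_tmp => v [r' /= r'0 <-].
have m0 : 0 < Num.min r r' by rewrite lt_min r0.
have [w Ow] := clx _ m0; rewrite /eball /= lt_min => /andP[wr wr'].
apply: (@le_trans _ _ (kob Om z w - kob Om o w)%:E).
  by apply: ereal_inf_lbound; exists w.
by apply: ereal_sup_ubound; exists w.
Qed.

End Localization.

(** * Limit points of horospheres *)

Theorem theorem1p4 (R : realType) (d : nat) (Om : set (Cd R d)) :
  domain Om -> kob_complete Om -> hyp_embedded Om ->
  locally_model_gromov_hyperbolic Om ->
  forall (x o : Cd R d) (Rr : R), bdry Om x -> Om o -> 0 < Rr ->
    closure (horo_s Om o x Rr) `&` bdry Om = [set x] /\
    closure (horo_b Om o x Rr) `&` bdry Om = [set x].
Proof.
move=> dO [hyp _] he lmg x o Rr bx Oo _.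
set e := 2^-1 * ln Rr.
have in_s : closure (horo_s Om o x Rr) x.
  apply/closure_eball => r r0.
  have [ o' [Oo' growth _ [C visible]]] := boundary_estimates dO hyp he lmg bx ltr01.
  (* With this bound on [kob Om z o'], the Busemann difference at [z] is at most [e - 1] for all [w]
     near [x]; the [1] secures the strict inequality. *)
  have [r1 r10 r1P] := growth (C + kob Om o o' + 1 - e).
  have m0 : 0 < Num.min r r1 by rewrite lt_min r0.
  have [z [Oz + [r' r'0 r'P]]] := visible _ m0.
  rewrite lt_min => /andP[zr zr1]; exists z => //; split=> //.
  apply: (@le_lt_trans _ _ (e - 1)%:E); last by rewrite lte_fin /e; lra.
  apply: ge_ereal_inf; eexists; first by exists r'.
  apply: ge_ereal_sup => u [w [Ow wr] <-]; rewrite lee_fin.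
  have := r'P w Ow wr; have := r1P z Oz zr1.
  have := kob_triangle dO Ow Oo Oo'; rewrite (kobC _ w z) (kobC _ w o); lra.
have sub : horo_s Om o x Rr `<=` horo_b Om o x Rr.
  move=> z [Oz zs]; split=> //; apply: le_lt_trans zs.
  by apply: busemann_liminf_le_limsup; case: bx.
have b_sub y : closure (horo_b Om o x Rr) y -> bdry Om y -> y = x.
  move=> /closure_eball cy by_; apply: contrapT => yx.
  have rho0 : 0 < nrm (y - x) / 2.
    by rewrite divr_gt0 // lt_neqAle nrm_ge0 andbT eq_sym nrm_eq0 subr_eq0; exact/eqP.
  have [ o' [Oo' _ [C [r r0 visible]] _]] := boundary_estimates dO hyp he lmg bx rho0.
  have [ o2 [Oo2 growth _ _]] := boundary_estimates dO hyp he lmg by_ ltr01.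
  (* Distances from the base point [o2] grow at [y]. Comparing [o2] with the base point [o'] at [x],
     and [o'] with [o], makes the Busemann difference at least [e] for [z] near [y]. *)
  have [r1 r10 r1P] := growth (e + kob Om o o' + kob Om o' o2 + C).
  have m0 : 0 < Num.min r1 (nrm (y - x) / 2) by rewrite lt_min r10.
  have [z [Oz zb]] := cy _ m0; rewrite /eball /= lt_min => /andP[zr1 zy].
  have zx : nrm (y - x) / 2 <= nrm (z - x).
    by have := nrm_triangle z y x; rewrite (nrm_distC y z); lra.
  move: zb; apply/negP; rewrite -leNgt.
  apply: le_ereal_sup_tmp; eexists; first by exists r.
  apply: le_ereal_inf_tmp => u [w [Ow wr] <-]; rewrite lee_fin.
  have := visible w z Ow Oz wr zx; have := r1P z Oz zr1.
  have := kob_triangle dO Oz Oo' Oo2; have := kob_triangle dO Oo Oo' Ow.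
  rewrite (kobC _ z w) (kobC _ z o') (kobC _ o' w) /e; lra.
have s_sub y : closure (horo_s Om o x Rr) y -> closure (horo_b Om o x Rr) y.
  exact: closure_subset.
split; apply/seteqP; split=> [y [cy by_]|_ ->] /=.
- exact: b_sub (s_sub _ cy) by_.
- by [].
- exact: b_sub.
- by split=> //; exact: s_sub.
Qed.
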